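(* Let $m\ge 2$ and let $A\subset \operatorname{Aut}(\mathbb T_m)$ be an automaton of linear activity growth (i.e. of degree $1$). Then the automaton group $\langle A\rangle\subset\operatorname{Aut}(\mathbb T_m)$ generated by $A$ is amenable.
   Context: $\mathbb T_m$ is the rooted $m$-ary tree whose vertices are the finite words over the alphabet $\{0,\dots,m-1\}$; the root is the empty word and the children of $w$ are the words $wx$, $x\in\{0,\dots,m-1\}$. $\operatorname{Aut}(\mathbb T_m)$ is its group of root-preserving automorphisms, acting on the right ($v\mapsto v.g$). For $g\in\operatorname{Aut}(\mathbb T_m)$ and a finite word $v$, the section $g(v)\in \operatorname{Aut}(\mathbb T_m)$ is the unique automorphism with $(vw).g=(v.g)\,(w.g(v))$ for all words $w$. An automaton is a finite subset $A\subset\operatorname{Aut}(\mathbb T_m)$ such that for every $a\in A$ and every letter $x$ the first-level section $a(x)$ also belongs to $A$; the automaton group of $A$ is the subgroup of $\operatorname{Aut}(\mathbb T_m)$ generated by $A$. For $a\in A$, let $N_a(n)$ be the number of words $v$ of length $n$ with $a(v)\neq 1$. As a function of $n$, $N_a(n)$ is eventually $0$, or grows polynomially of some degree $d\ge 0$ (it lies between two positive constant multiples of $n^d$ for all large $n$), or grows exponentially; the degree of $a$ is respectively $-1$, $d$, $\infty$. The degree of the automaton is the maximum of the degrees of its elements. Linear activity means degree $1$. *)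

(* Defs.v *)
From HB Require Import structures.
From mathcomp Require Import all_boot all_order all_algebra.
From mathcomp Require Import all_classical all_reals all_analysis.

Set Implicit Arguments.
Unset Strict Implicit.
Unset Printing Implicit Defensive.

Import Order.TTheory GRing.Theory Num.Theory.

Local Open Scope classical_set_scope.
Local Open Scope group_scope.

(* The vertices of the rooted [m]-ary tree are the words [v : seq 'I_m]. *)
Definition adjacent m (v w : seq 'I_m) : Prop :=
  (exists x, w = rcons v x) \/ (exists x, v = rcons w x).

(* For [g : treeaut m], the application [g v] is the right action v.g. *)
Record treeaut m := TreeAut {
  treeaut_fun :> seq 'I_m -> seq 'I_m;
  treeaut_bij : bijective treeaut_fun;
  treeaut_root : treeaut_fun [::] = [::];
  treeaut_adj : forall v w,
    adjacent (treeaut_fun v) (treeaut_fun w) <-> adjacent v w }.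

HB.instance Definition _ m := gen_eqMixin (treeaut m).
HB.instance Definition _ m := gen_choiceMixin (treeaut m).

Section Group.
Variable m : nat.
Implicit Types g h : treeaut m.

Lemma treeautP g h : g =1 h -> g = h.
Proof.
case: g h => [f fb f0 fa] [k kb k0 ka] /= /funext fk.
by subst k; congr TreeAut; exact: Prop_irrelevance.
Qed.

Definition treeaut_one : treeaut m :=
  @TreeAut m id (Bijective (fun=> erefl) (fun=> erefl)) erefl
    (fun _ _ => iff_refl _).

Fact treeaut_mul_root g h : h (g [::]) = [::].
Proof. by rewrite !treeaut_root. Qed.

Fact treeaut_mul_adj g h v w :
  adjacent (h (g v)) (h (g w)) <-> adjacent v w.
Proof. by rewrite !treeaut_adj. Qed.

(* Right action: v.(gh) = (v.g).h. *)
Definition treeaut_mul g h : treeaut m :=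
  @TreeAut m (h \o g) (bij_comp (treeaut_bij h) (treeaut_bij g))
    (treeaut_mul_root g h) (treeaut_mul_adj g h).

Fact treeaut_has_inv g : exists h : treeaut m, cancel g h /\ cancel h g.
Proof.
have [k gk kg] := treeaut_bij g.
have k0 : k [::] = [::] by rewrite -{1}(treeaut_root g) gk.
have ka v w : adjacent (k v) (k w) <-> adjacent v w.
  by rewrite -(treeaut_adj g) !kg.
by exists (TreeAut (Bijective kg gk) k0 ka).
Qed.

Definition treeaut_inv g : treeaut m := sval (cid (treeaut_has_inv g)).

Lemma treeautK g : cancel g (treeaut_inv g).
Proof. by rewrite /treeaut_inv; case: cid => h []. Qed.

Lemma treeautVK g : cancel (treeaut_inv g) g.
Proof. by rewrite /treeaut_inv; case: cid => h []. Qed.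

Fact treeaut_mulA : associative treeaut_mul.
Proof. by move=> f g h; exact: treeautP. Qed.

Fact treeaut_mul1 : left_id treeaut_one treeaut_mul.
Proof. by move=> g; exact: treeautP. Qed.

Fact treeaut_mulr1 : right_id treeaut_one treeaut_mul.
Proof. by move=> g; exact: treeautP. Qed.

Fact treeaut_mulV : left_inverse treeaut_one treeaut_inv treeaut_mul.
Proof. by move=> g; apply: treeautP => v /=; rewrite treeautVK. Qed.

Fact treeaut_mulrV : right_inverse treeaut_one treeaut_inv treeaut_mul.
Proof. by move=> g; apply: treeautP => v /=; rewrite treeautK. Qed.

End Group.

HB.instance Definition _ m := isGroup.Build (treeaut m)
  (@treeaut_mulA m) (@treeaut_mul1 m) (@treeaut_mulr1 m)
  (@treeaut_mulV m) (@treeaut_mulrV m).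

Section Sections.
Variable m : nat.
Implicit Types (g h : treeaut m) (v w : seq 'I_m).

Lemma treeaut_inj g : injective g.
Proof. exact: bij_inj (treeaut_bij g). Qed.

Lemma treeaut_rcons g v x : exists y, g (rcons v x) = rcons (g v) y.
Proof.
elim/last_ind: v x => [|u z IHu] x.
  have: adjacent (g [::]) (g [:: x]) by rewrite treeaut_adj; left; exists x.
  rewrite treeaut_root => -[[y ->]|[y]]; first by exists y.
  by move/(congr1 size); rewrite size_rcons.
have: adjacent (g (rcons u z)) (g (rcons (rcons u z) x)).
  by rewrite treeaut_adj; left; exists x.
case=> // -[y]; have [z' ->] := IHu z; move/rcons_inj => -[/treeaut_inj].
by move/(congr1 size)/eqP; rewrite !size_rcons ltn_eqF.
Qed.

Lemma size_treeaut g v : size (g v) = size v.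
Proof.
elim/last_ind: v => [|v x IHv]; first by rewrite treeaut_root.
by have [y ->] := treeaut_rcons g v x; rewrite !size_rcons IHv.
Qed.

Lemma treeaut_prefix g v w : exists u, g (v ++ w) = g v ++ u.
Proof.
elim/last_ind: w => [|w x [u IHw]]; first by exists [::]; rewrite !cats0.
rewrite -rcons_cat; have [y ->] := treeaut_rcons g (v ++ w) x.
by exists (rcons u y); rewrite IHw rcons_cat.
Qed.

Definition section_fun g v w := drop (size v) (g (v ++ w)).

Lemma section_funE g v w : g (v ++ w) = g v ++ section_fun g v w.
Proof.
have [u guE] := treeaut_prefix g v w.
by rewrite /section_fun guE -(size_treeaut g v) drop_size_cat.
Qed.

Fact section_fun_root g v : section_fun g v [::] = [::].
Proof. by rewrite /section_fun cats0 drop_oversize // size_treeaut. Qed.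

Lemma adjacent_cat (u v w : seq 'I_m) :
  adjacent (u ++ v) (u ++ w) <-> adjacent v w.
Proof.
have cat_inj (s t : seq 'I_m) : u ++ s = u ++ t -> s = t.
  by move/eqP; rewrite eqseq_cat // eqxx => /eqP.
rewrite /adjacent; split=> -[] [x].
- by rewrite rcons_cat => /cat_inj ->; left; exists x.
- by rewrite rcons_cat => /cat_inj ->; right; exists x.
- by move->; left; exists x; rewrite rcons_cat.
- by move->; right; exists x; rewrite rcons_cat.
Qed.

Fact section_fun_adj g v w1 w2 :
  adjacent (section_fun g v w1) (section_fun g v w2) <-> adjacent w1 w2.
Proof.
by rewrite -(adjacent_cat (g v)) -!section_funE treeaut_adj adjacent_cat.
Qed.

Lemma section_funK g v :
  cancel (section_fun g v) (section_fun (treeaut_inv g) (g v)).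
Proof.
move=> w; rewrite {1}/section_fun -section_funE treeautK size_treeaut.
exact: drop_size_cat.
Qed.

Fact section_fun_bij g v : bijective (section_fun g v).
Proof.
exists (section_fun (treeaut_inv g) (g v)); first exact: section_funK.
move=> w; rewrite {1}/section_fun -[X in g (X ++ _)](treeautK g v).
by rewrite -section_funE treeautVK -(size_treeaut g v) drop_size_cat.
Qed.

Definition treeaut_section g v : treeaut m :=
  TreeAut (section_fun_bij g v) (section_fun_root g v) (section_fun_adj g v).

Lemma treeaut_sectionE g v w : g (v ++ w) = g v ++ treeaut_section g v w.
Proof. exact: section_funE. Qed.

Lemma treeaut_section_unique g v h :
  (forall w, g (v ++ w) = g v ++ h w) -> h = treeaut_section g v.
Proof.
move=> gh; apply: treeautP => w; have := gh w.
by rewrite treeaut_sectionE => /eqP; rewrite eqseq_cat // eqxx => /eqP.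
Qed.

End Sections.

Definition automaton m (A : set (treeaut m)) : Prop :=
  finite_set A /\
  forall a, A a -> forall x : 'I_m, A (treeaut_section a [:: x]).

Definition activity m (a : treeaut m) (n : nat) : nat :=
  #|[set v : n.-tuple 'I_m | treeaut_section a v != 1]%SET|.

(* No upper bound is required of exponential growth: [activity a n <= m ^ n]
   always holds. *)
Inductive has_degree (R : realType) (N : nat -> nat) : \bar int -> Prop :=
| has_degree_finitary :
    (\forall n \near \oo, N n = 0%N) -> has_degree R N (- 1)%:E%R
| has_degree_polynomial (d : nat) (c C : R) : (0 < c)%R -> (0 < C)%R ->
    (\forall n \near \oo,
       (c * n%:R ^+ d <= (N n)%:R)%R /\ ((N n)%:R <= C * n%:R ^+ d)%R) ->
    has_degree R N (d%:Z)%:E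
| has_degree_exponential (b : R) : (1 < b)%R ->
    (\forall n \near \oo, (b ^+ n <= (N n)%:R)%R) ->
    has_degree R N +oo%E.

(* The three growth types are mutually exclusive, and exhaustive when [a]
   belongs to an automaton, so the default value of [xget] plays no role. *)
Definition degree (R : realType) m (a : treeaut m) : \bar int :=
  xget +oo%E [set d | has_degree R (activity a) d].

Definition automaton_degree (R : realType) m (A : set (treeaut m)) : \bar int :=
  \big[maxe/-oo%E]_(a \in A) degree R a.

Definition generated_subgroup (G : groupType) (A : set G) : set G :=
  smallest [set H : set G | group_closed (mem H)] A.

(* Amenability of a subgroup [H]: a left-invariant finitely additive
   probability measure on the subsets of [H]; the values of [mu] on sets not
   included in [H] are unconstrained. *)
Definition amenable (R : realType) (G : groupType) (H : set G) : Prop :=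
  exists mu : set G -> R,
    [/\ mu H = 1%R,
        forall X, X `<=` H -> (0 <= mu X)%R,
        forall X Y, X `<=` H -> Y `<=` H -> X `&` Y = set0 ->
          mu (X `|` Y) = (mu X + mu Y)%R
      & forall h X, H h -> X `<=` H -> mu [set h * x | x in X] = mu X].

(* Main.v *)
(* Write [E] for the group obtained from a self-similar group [N] by allowing,
   below some level, sections that are directed over [N]: equal to their own
   section at one letter, with all other sections in [N].  Iterating this twice
   from the finitary automorphisms, over the alphabet of blocks of a suitable
   length, produces a group that contains every automaton of linear activity;
   amenability is carried from [N] to [E].

   An element of [E] has a germ at each eventually constant ray, lying in [N]
   except at finitely many rays, and it is determined modulo [N] by its germs.
   So [E / N] is a set of finitely supported families of germs, and since the
   isotropy groups of germs are amenable, an invariant mean on [E / N] follows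
   from one on finite sets of rays that contain any prescribed finite set
   (extensive amenability of the action on rays, in the sense of Juschenko,
   Matte Bon, Monod and de la Salle).  The latter comes from recurrence: linear
   activity bounds by O(n) the number of edges leaving the set [C_n] of rays
   that are constant from position [n] on, so the potential sum_n 1_{C_n} / n,
   normalized, has small Dirichlet energy, and the random set that retains each
   ray independently with a probability depending on the potential is almost
   invariant in Hellinger distance. *)
Require Import Defs.
From mathcomp Require Import all_boot all_order all_algebra all_fingroup.
From mathcomp Require Import all_classical all_reals all_analysis.
From mathcomp Require Import ring lra zify.

Set Implicit Arguments.
Unset Strict Implicit.
Unset Printing Implicit Defensive.

Import Order.TTheory GRing.Theory Num.Theory.
Import numFieldNormedType.Exports.

(** * Means on bounded functions *)

Section Means.
Local Open Scope classical_set_scope.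
Local Open Scope ring_scope.
Variable R : realType.

Definition bounded_fct T (u : T -> R) := exists C : R, forall x, `|u x| <= C.

Lemma bndC T (c : R) : bounded_fct (fun _ : T => c).
Proof. by exists `|c|. Qed.

Lemma bndD T (u v : T -> R) : bounded_fct u -> bounded_fct v -> bounded_fct (fun x => u x + v x).
Proof.
move=> [C uC] [D vD]; exists (C + D) => x.
exact: le_trans (ler_normD _ _) (lerD (uC x) (vD x)).
Qed.

Lemma bndZ T (a : R) (u : T -> R) : bounded_fct u -> bounded_fct (fun x => a * u x).
Proof.
by move=> [C uC]; exists (`|a| * C) => x; rewrite normrM ler_wpM2l.
Qed.

Lemma bndB T (u v : T -> R) : bounded_fct u -> bounded_fct v -> bounded_fct (fun x => u x - v x).
Proof.
move=> [C uC] [D vD]; exists (C + D) => x.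
exact: le_trans (ler_normB _ _) (lerD (uC x) (vD x)).
Qed.

Lemma bnd_comp S T (f : S -> T) (u : T -> R) : bounded_fct u -> bounded_fct (fun x => u (f x)).
Proof. by move=> [C uC]; exists C => x. Qed.

(* Positivity is only tested on [A], which makes [A] carry the whole mass. *)
Record mean T (A : set T) (M : (T -> R) -> R) : Prop := Mean {
  mean1 : M (fun=> 1) = 1;
  meanD : forall u v, bounded_fct u -> bounded_fct v -> M (fun x => u x + v x) = M u + M v;
  meanZ : forall a u, bounded_fct u -> M (fun x => a * u x) = a * M u;
  mean_ge0 : forall u, bounded_fct u -> (forall x, A x -> 0 <= u x) -> 0 <= M u }.

Section MeanTheory.
Variables (T : Type) (A : set T) (M : (T -> R) -> R) (mM : mean A M).

Lemma meanC c : M (fun=> c) = c.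
Proof.
have := meanZ mM c (bndC T 1); rewrite (mean1 mM) mulr1 => {2}<-.
by congr M; apply/funext => x; rewrite mulr1.
Qed.

Lemma meanB u v : bounded_fct u -> bounded_fct v -> M (fun x => u x - v x) = M u - M v.
Proof.
move=> bu bv; have bv' := bndZ (-1) bv.
have -> : (fun x => u x - v x) = (fun x => u x + (-1) * v x).
  by apply/funext => x; rewrite mulN1r.
by rewrite (meanD mM) // (meanZ mM) // mulN1r.
Qed.

Lemma mean_le u v : bounded_fct u -> bounded_fct v -> (forall x, A x -> u x <= v x) ->
  M u <= M v.
Proof.
move=> bu bv uv; rewrite -subr_ge0 -meanB //.
by apply: (mean_ge0 mM) (bndB bv bu) _ => x Ax; rewrite subr_ge0 uv.
Qed.

Lemma eq_mean u v : bounded_fct u -> bounded_fct v -> (forall x, A x -> u x = v x) -> M u = M v.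
Proof.
by move=> bu bv uv; apply/eqP; rewrite eq_le !mean_le // => x Ax; rewrite uv.
Qed.

Lemma mean_norm C u : (forall x, `|u x| <= C) -> `|M u| <= C.
Proof.
move=> uC; have bu : bounded_fct u by exists C.
have uC' x : - C <= u x <= C by rewrite -ler_norml.
rewrite ler_norml; apply/andP.
split; [rewrite -[leLHS]meanC|rewrite -[leRHS]meanC];
  apply: mean_le => //; try (by exact: bndC); move=> x _.
- by case/andP: (uC' x).
- by case/andP: (uC' x).
Qed.

End MeanTheory.

Lemma mean_sub T (A B : set T) M : A `<=` B -> mean A M -> mean B M.
Proof.
move=> AB [M1 MD MZ M0]; split=> // u bu u0.
by apply: M0 => // x /AB; exact: u0.
Qed.

Lemma mean_dirac T (A : set T) x : A x -> mean A (fun u => u x).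
Proof. by move=> Ax; split=> // u _; apply. Qed.

Lemma bnd_mean S T (n : S -> (T -> R) -> R) (u : S -> T -> R) :
  (forall x, mean setT (n x)) -> (exists C : R, forall x y, `|u x y| <= C) ->
  bounded_fct (fun x => n x (u x)).
Proof. by move=> mn [C uC]; exists C => x; exact: (mean_norm (mn x)). Qed.

Lemma mean_bind S T (A : set S) (B : set T) m (n : S -> (T -> R) -> R) :
  mean A m -> (forall x, mean setT (n x)) -> (forall x, A x -> mean B (n x)) ->
  mean B (fun u => m (fun x => n x u)).
Proof.
move=> mm mn nB.
have bn u : bounded_fct u -> bounded_fct (fun x => n x u).
  by move=> [C uC]; apply: bnd_mean => //; exists C.
split.
- rewrite -[RHS](mean1 mm); congr m; apply/funext => x; exact: (mean1 (mn x)).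
- move=> u v bu bv; rewrite -(meanD mm) //; try exact: bn.
  by congr m; apply/funext => x; rewrite (meanD (mn x)).
- move=> a u bu; rewrite -(meanZ mm) //; try exact: bn.
  by congr m; apply/funext => x; rewrite (meanZ (mn x)).
- move=> u bu u0; apply: (mean_ge0 mm) (bn _ bu) _ => x Ax.
  exact: (mean_ge0 (nB x Ax)).
Qed.

Lemma mean_image S T (A : set S) (B : set T) m (f : S -> T) :
  mean A m -> (forall x, A x -> B (f x)) -> mean B (fun u => m (fun x => u (f x))).
Proof.
move=> mm fAB; apply: (mean_bind (n := fun x u => u (f x)) mm).
  by move=> x; exact: mean_dirac.
by move=> x Ax; apply: mean_dirac; exact: fAB.
Qed.

Lemma mean_unif (T : finType) : (0 < #|T|)%N ->
  mean setT (fun u : T -> R => #|T|%:R^-1 * \sum_x u x).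
Proof.
move=> T0; have n0 : #|T|%:R != 0 :> R by rewrite pnatr_eq0 -lt0n.
split.
- by rewrite sumr_const mulVf.
- by move=> u v _ _; rewrite big_split mulrDr.
- by move=> a u _; rewrite -mulr_sumr mulrCA.
- move=> u _ u0; apply: mulr_ge0; first by rewrite invr_ge0.
  by apply: sumr_ge0 => x _; exact: u0.
Qed.

Lemma ultra_fmap (S T : Type) (f : S -> T) (U : set_system S) :
  UltraFilter U -> UltraFilter (f @ U).
Proof.
move=> UU; split; first exact: fmap_proper_filter.
move=> G GF sUG; apply/seteqP; split=> // A GA.
have [//|UnA] := in_ultra_setVsetC (f @^-1` A) UU.
have GnA : G (~` A) by apply: sUG.
by have /filter_ex [? []] : G (A `&` ~` A) by exact: filterI.
Qed.

Lemma mean_carrier T (A : set T) M : mean setT M ->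
  (forall u, bounded_fct u -> (forall x, A x -> 0 <= u x) -> 0 <= M u) -> mean A M.
Proof. by move=> [M1 MD MZ _] M0; split. Qed.

(** Values at a fixed bounded function stay in a compact interval, so they converge along an
    ultrafilter refining [F]. Approximate invariance along [F] thereby becomes exact invariance. *)
Lemma mean_ultralimit (I T : Type) (F : set_system I) (M_ : I -> (T -> R) -> R) :
  ProperFilter F -> (forall i, mean setT (M_ i)) ->
  exists M, [/\ mean setT M,
    forall u, bounded_fct u -> F [set i | 0 <= M_ i u] -> 0 <= M u &
    forall u v, bounded_fct u -> bounded_fct v ->
      (forall e : R, 0 < e -> F [set i | `|M_ i u - M_ i v| <= e]) -> M u = M v].
Proof.
move=> FF mM; have [U [UF FU]] := ultraFilterLemma FF.
have limE u : bounded_fct u -> exists l : R, (fun i => M_ i u) @ U --> l.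
  move=> [C uC].
  have cC : compact `[- C, C] by exact: segment_compact.
  have UU : UltraFilter ((fun i => M_ i u) @ U) by exact: ultra_fmap.
  move: cC; rewrite compact_ultra => /(_ _ UU) [|l [_ Ul]].
    suff : U ((fun i => M_ i u) @^-1` `[- C, C]) by [].
    apply: (@filterS _ U _ setT _ _ filterT) => i _.
    by rewrite /= in_itv /= -ler_norml; exact: (mean_norm (mM i) uC).
  by exists l.
(* The default 0 can only be met at unbounded functions, about which means assert nothing. *)
pose M u := xget 0 (fun l : R => ((fun i => M_ i u) @ U --> l : Prop)).
have ML u : bounded_fct u -> (fun i => M_ i u) @ U --> M u.
  by move=> /limE [l Ul]; rewrite /M; case: xgetP => [l' _ //|/(_ l)].
have Mu u l : bounded_fct u -> (fun i => M_ i u) @ U --> l -> M u = l.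
  by move=> bu Ul; apply: cvg_unique Ul; [exact: Rhausdorff|exact: ML].
have M0 u : bounded_fct u -> F [set i | 0 <= M_ i u] -> 0 <= M u.
  move=> bu u0; apply: (@closed_cvg _ _ _ _ _ (fun x : R => 0 <= x)) (ML _ bu).
    exact: closed_ge.
  by apply: FU; exact: u0.
exists M; split; first split.
- apply: Mu; first exact: bndC.
  by under eq_fun do rewrite (mean1 (mM _)); exact: cvg_cst.
- move=> u v bu bv; apply: Mu; first exact: bndD.
  under eq_fun do rewrite (meanD (mM _)) //.
  by apply: cvgD; exact: ML.
- move=> a u bu; apply: Mu; first exact: bndZ.
  under eq_fun do rewrite (meanZ (mM _)) //.
  by apply: cvgMl_tmp; exact: ML.
- move=> u bu u0; apply: M0 => //; apply: filterS filterT => i _.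
  exact: (mean_ge0 (mM i)).
- exact: M0.
move=> u v bu bv uv; apply/eqP; rewrite -subr_eq0 -normr_le0.
have Mc : (fun i => `|M_ i u - M_ i v|) @ U --> `|M u - M v|.
  by apply: cvg_norm; apply: cvgB; exact: ML.
apply/ler_addgt0Pr => e e0; rewrite add0r.
apply: (@closed_cvg _ _ _ _ _ (fun x : R => x <= e)) Mc.
  exact: closed_le.
by apply: FU; exact: uv.
Qed.

End Means.

(** * Amenable subgroups *)

Section Amenable.
Local Open Scope classical_set_scope.
Local Open Scope ring_scope.
Variable R : realType.

(** Means on functions, unlike measures on sets, can be integrated against one another directly
    through [mean_bind]. *)
Definition mean_amenable (G : groupType) (H : set G) :=
  exists M : (G -> R) -> R, mean H M /\
    forall h u, H h -> bounded_fct u -> M (fun x => u (h * x)%g) = M u.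

Definition is_subgroup (G : groupType) (H : set G) :=
  [/\ H 1%g, forall x y, H x -> H y -> H (x * y)%g & forall x, H x -> H x^-1%g].

(** The elements carrying the representative [r z] of an orbit to [z] form a coset
    [t z * Stab (r z)]. Pushing the mean of the stabilizer to this coset does not depend on the
    choice of [t z], so [z] is sent equivariantly to a mean on [H]; integrating over [m] gives an
    invariant mean. *)
Lemma amen_action (G : groupType) (H : set G) (Z : Type) (z0 : Z)
    (a : G -> Z -> Z) (m : (Z -> R) -> R) :
  is_subgroup H -> (forall z, a 1%g z = z) ->
  (forall g h z, H g -> H h -> a (g * h)%g z = a g (a h z)) ->
  mean setT m -> (forall g u, H g -> bounded_fct u -> m (fun z => u (a g z)) = m u) ->
  (forall z, mean_amenable [set h | H h /\ a h z = z]) -> mean_amenable H.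
Proof.
move=> [H1 HM HV] a1 aM mm minv /choice [n nP].
pose orb z := [set y | exists2 h, H h & a h y = z].
have orbP z : orb z z by exists 1%g.
have orbM h z : H h -> orb (a h z) = orb z.
  move=> Hh; apply/seteqP; split=> y [k Hk kE].
    exists (h^-1 * k)%g; first by apply: HM => //; exact: HV.
    by rewrite aM ?kE -?aM ?mulVg //; exact: HV.
  by exists (h * k)%g; [exact: HM|rewrite aM // kE].
have /choice [rho rhoP] : forall P : set Z, exists z, P !=set0 -> P z.
  move=> P; have [[z Pz]|nP0] := pselect (P !=set0); first by exists z.
  by exists z0.
pose r z := rho (orb z).
have /choice [t tP] z : exists t, H t /\ a t (r z) = z.
  have [|h Hh hE] := rhoP (orb z); first by exists z.
  by exists h.
have nT z : mean setT (n z) := mean_sub (@subsetT _ _) (nP z).1.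
exists (fun u => m (fun z => n (r z) (fun k => u (t z * k)%g))); split.
  apply: (mean_bind (n := fun z u => n (r z) (fun k => u (t z * k)%g)) mm) => z.
    exact: (mean_image (f := fun k => t z * k)%g (nT (r z))).
  move=> _; apply: (mean_image (f := fun k => t z * k)%g (nP (r z)).1) => k [Hk _].
  by apply: HM => //; case: (tP z).
move=> h u Hh bu.
pose phi z := n (r z) (fun k => u (t z * k)%g).
have bphi : bounded_fct phi.
  apply: (bnd_mean (n := fun z => n (r z)) (u := fun z k => u (t z * k)%g)) => //.
  by have [C uC] := bu; exists C.
rewrite -[RHS]/(m phi) -[RHS](minv h) //; congr m; apply/funext => z.
have rE : r (a h z) = r z by rewrite /r orbM.
rewrite /phi rE.
have [Htz tzE] := tP z; have [Hth thE] := tP (a h z); rewrite rE in thE.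
(* The two translates [h * t z] and [t (a h z)] differ by an element of the stabilizer of [r z],
   under which its mean is invariant. *)
rewrite -[RHS]((nP (r z)).2 ((t (a h z))^-1 * (h * t z))%g).
- by congr n; apply/funext => k; rewrite -!mulgA mulVKg.
- split; first by apply: (HM); [exact: HV|exact: HM].
  rewrite aM ?aM ?tzE //; [|exact: HV|exact: HM].
  by rewrite -{2}thE -aM ?mulVg //; exact: HV.
- exact: bnd_comp.
Qed.

Lemma amen_unit (G : groupType) (H : set G) : is_subgroup H ->
  (forall h, H h -> h = 1%g) -> mean_amenable H.
Proof.
move=> [H1 _ _] HE; exists (fun u => u 1%g); split; first exact: mean_dirac.
by move=> h u /HE -> _; rewrite mul1g.
Qed.

Lemma eq_amen (G : groupType) (H K : set G) :
  (forall x, H x <-> K x) -> mean_amenable H -> mean_amenable K.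
Proof. by move=> HK; rewrite (_ : H = K) //; apply/seteqP; split=> x /HK. Qed.

(** [H] acts on [K] by left translation through [f]; the mean of [N] is invariant for this action
    and every point stabilizer is the kernel. *)
Lemma amen_hom (G K : groupType) (H : set G) (N : set K) (f : G -> K) :
  is_subgroup H -> (forall g h, H g -> H h -> f (g * h) = f g * f h)%g ->
  f 1%g = 1%g -> (forall h, H h -> N (f h)) -> mean_amenable N ->
  mean_amenable [set h | H h /\ f h = 1%g] -> mean_amenable H.
Proof.
move=> sH fM f1 HN [m [mm minv]] aker.
apply: (@amen_action _ H K 1%g (fun g x => f g * x)%g m) => //.
- by move=> z; rewrite f1 mul1g.
- by move=> g h z Hg Hh; rewrite fM // mulgA.
- exact: mean_sub (@subsetT _ _) mm.
- by move=> g u Hg bu; rewrite minv //; exact: HN.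
- move=> z; apply: eq_amen aker => h /=; split=> -[Hh]; first by move->; rewrite mul1g.
  by move=> hz; split=> //; apply: (@mulIg _ z); rewrite mul1g.
Qed.

Lemma amen_subset (G : groupType) (H K : set G) :
  is_subgroup H -> H `<=` K -> mean_amenable K -> mean_amenable H.
Proof.
move=> sH HK aK; apply: (amen_hom (f := id) sH _ _ HK aK) => //.
apply: amen_unit => [|h []//]; case: sH => H1 HM HV.
split=> [|x y [Hx ->] [Hy ->]|x [Hx ->]]; split=> //.
- exact: HM.
- by rewrite mulg1.
- exact: HV.
- by rewrite invg1.
Qed.

Lemma amen_finite (K : finGroupType) : mean_amenable [set: K].
Proof.
exists (fun u => #|K|%:R^-1 * \sum_x u x); split.
  by apply: mean_unif; apply/card_gt0P; exists 1%g.
by move=> h u _ _; rewrite [in RHS](reindex_inj (mulgI h)).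
Qed.

Lemma amen_amenable (G : groupType) (H : set G) : is_subgroup H -> mean_amenable H -> amenable R H.
Proof.
move=> [H1 HM HV] [M [mM Minv]].
have bI X : bounded_fct (\1_X : G -> R).
  by exists 1 => x; rewrite indicE; case: (_ \in _); rewrite ?normr1 ?normr0.
exists (fun X => M \1_X); split.
- rewrite -[RHS](meanC mM); apply: (eq_mean mM) => //; first exact: bndC.
  by move=> x Hx; rewrite indicE mem_set.
- by move=> X _; apply: (mean_ge0 mM) => // x _; rewrite indicE ler0n.
- move=> X Y XH YH XY0; rewrite -(meanD mM) //; congr M; apply/funext => x.
  have : ~~ ((x \in X) && (x \in Y)) by rewrite -in_setI XY0 in_set0.
  by rewrite !indicE in_setU; case: (x \in X) (x \in Y) => -[] //= _; rewrite ?addr0 ?add0r.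
- move=> h X Hh XH; rewrite -(Minv h) //; congr M; apply/funext => x.
  rewrite !indicE; congr (nat_of_bool _)%:R.
  apply/idP/idP; rewrite !inE; first by case=> y Xy /mulgI <-.
  by exists x.
Qed.

End Amenable.

(** * Self-similar groups and directed extensions *)

(** Kept abstract so that blocks of letters of a fixed length can serve as the alphabet.
    [ss_portrait] is what allows elements with prescribed germs to be built. *)
Record self_similar (G : groupType) (B : finType) := SelfSim {
  ss_act : G -> B -> B;
  ss_sec : G -> B -> G;
  ss_act1 : forall x, ss_act 1%g x = x;
  ss_actM : forall g h x, ss_act (g * h)%g x = ss_act h (ss_act g x);
  ss_secM : forall g h x,
    ss_sec (g * h)%g x = (ss_sec g x * ss_sec h (ss_act g x))%g;
  (* Coinductive form of the faithfulness of the action on words. *)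
  ss_faithful : forall P : set G,
    (forall g, P g -> forall x, ss_act g x = x /\ P (ss_sec g x)) ->
    forall g, P g -> g = 1%g;
  ss_portrait : forall f : B -> G,
    exists g, forall x, ss_act g x = x /\ ss_sec g x = f x }.

Lemma max_bound (B : finType) (P : B -> nat -> Prop) :
  (forall x m n, (m <= n)%N -> P x m -> P x n) ->
  (forall x, exists n, P x n) -> exists n, forall x, P x n.
Proof.
move=> Pm /choice [f fP]; exists (\max_x f x) => x.
by apply: Pm (fP x); exact: leq_bigmax.
Qed.

Section SelfSimilar.
Local Open Scope classical_set_scope.
Local Open Scope group_scope.
Variables (G : groupType) (B : finType) (S : self_similar G B).
Implicit Types (g h : G) (x y : B) (N : set G).
Local Notation act := (ss_act S).
Local Notation sec := (ss_sec S).

Lemma ss_sec1 x : sec 1 x = 1.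
Proof.
have := ss_secM S 1 1 x; rewrite mulg1 ss_act1 => /esym s1.
by apply: (@mulgI _ (sec 1 x)); rewrite s1 mulg1.
Qed.

Lemma ss_actK g : cancel (act g) (act g^-1).
Proof. by move=> x; rewrite -ss_actM mulgV ss_act1. Qed.

Lemma ss_actVK g : cancel (act g^-1) (act g).
Proof. by move=> x; rewrite -ss_actM mulVg ss_act1. Qed.

Lemma ss_secV g x : sec g^-1 (act g x) = (sec g x)^-1.
Proof.
by apply/esym/mulg1_eq; rewrite -ss_secM mulgV ss_sec1.
Qed.

Definition ray_shift (xi : nat -> B) : nat -> B := fun n => xi n.+1.
Definition ray_cons x (xi : nat -> B) : nat -> B :=
  fun n => if n is k.+1 then xi k else x.

Lemma ray_cons_shift xi : ray_cons (xi 0%N) (ray_shift xi) = xi.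
Proof. by apply/funext => -[]. Qed.

Fixpoint ray_section g (xi : nat -> B) n :=
  if n is k.+1 then sec (ray_section g xi k) (xi k) else g.

Definition ray_act g (xi : nat -> B) : nat -> B := fun n => act (ray_section g xi n) (xi n).

Lemma secpS g xi n : ray_section g xi n.+1 = ray_section (sec g (xi 0%N)) (ray_shift xi) n.
Proof. by elim: n => //= n ->. Qed.

Lemma secpD g xi n k :
  ray_section g xi (n + k) = ray_section (ray_section g xi n) (fun i => xi (n + i)%N) k.
Proof. by elim: k => [|k IH]; rewrite ?addn0 // addnS /= IH. Qed.

Lemma secp1 xi n : ray_section 1 xi n = 1.
Proof. by elim: n => //= n ->; rewrite ss_sec1. Qed.

Lemma rayact1 xi : ray_act 1 xi = xi.
Proof. by apply/funext => n; rewrite /ray_act secp1 ss_act1. Qed.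

Lemma secpM g h xi n : ray_section (g * h) xi n = ray_section g xi n * ray_section h (ray_act g xi) n.
Proof. by elim: n => //= n ->; rewrite ss_secM. Qed.

Lemma rayactM g h xi : ray_act (g * h) xi = ray_act h (ray_act g xi).
Proof. by apply/funext => n; rewrite /ray_act secpM ss_actM. Qed.

Lemma rayactK g : cancel (ray_act g) (ray_act g^-1).
Proof. by move=> xi; rewrite -rayactM mulgV rayact1. Qed.

Lemma rayactVK g : cancel (ray_act g^-1) (ray_act g).
Proof. by move=> xi; rewrite -rayactM mulVg rayact1. Qed.

Definition const_from n (xi : nat -> B) := forall k, (n <= k)%N -> xi k = xi n.

Lemma tailc_le m n xi : (m <= n)%N -> const_from m xi -> const_from n xi.
Proof.
by move=> mn xiC k nk; rewrite xiC ?(leq_trans mn) // -(xiC n).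
Qed.

Lemma tailc_ray_shift n xi : const_from n.+1 xi -> const_from n (ray_shift xi).
Proof. by move=> xiC k nk; exact: xiC. Qed.

(* The position where the sections stabilize is uniform in the ray, which makes
   [g] map rays constant from [n] to rays constant from [n + K]. *)
Definition stabilizes K g := forall n xi, const_from n xi -> forall k, (n + K <= k)%N ->
  ray_section g xi k.+1 = ray_section g xi k.

Lemma uec_le m n g : (m <= n)%N -> stabilizes m g -> stabilizes n g.
Proof.
move=> mn gC l xi xiC k lk; apply: gC xiC _ _.
by apply: leq_trans lk; rewrite leq_add2l.
Qed.

Lemma uec_sec K g : (forall x, stabilizes K (sec g x)) -> stabilizes K.+1 g.
Proof.
move=> gC n xi xiC [|k]; first by rewrite addnS.
rewrite addnS ltnS => nk.
rewrite (secpS g xi k.+1) (secpS g xi k); apply: (gC _ n) => //.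
by apply: tailc_ray_shift; exact: tailc_le xiC.
Qed.

(** [ext] preserves these conditions ([ext_good]), so the extension can be iterated. [good_full]
    lets membership be tested on sections, hence on germs. *)
Record section_group N : Prop := Good {
  good_sgp : is_subgroup N;
  good_sec : forall g x, N g -> N (sec g x);
  good_full : forall g, (forall x, N (sec g x)) -> N g;
  good_uec : forall g, N g -> exists K, stabilizes K g }.

Definition directed N g := exists2 x, sec g x = g & forall y, y != x -> N (sec g y).

(* As [B] is finite, this says that all sections below some level lie in [N] or
   are directed over [N]. *)
Inductive ext N : G -> Prop :=
| ext_in g : N g -> ext N g
| ext_dir g : directed N g -> ext N g
| ext_sec g : (forall x, ext N (sec g x)) -> ext N g.

Section Ext.
Variables (N : set G) (gN : section_group N).
Let N1 : N 1. Proof. by case: (good_sgp gN). Qed.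
Let NM g h : N g -> N h -> N (g * h).
Proof. by case: (good_sgp gN) => _ + _; apply. Qed.
Let NV g : N g -> N g^-1.
Proof. by case: (good_sgp gN) => _ _; apply. Qed.
Let NS g x : N g -> N (sec g x). Proof. exact: good_sec. Qed.

Lemma ext_section g x : ext N g -> ext N (sec g x).
Proof.
case=> {}g; first by move=> Ng; apply/ext_in/NS.
  move=> [y yE yN]; have [->|/yN] := eqVneq x y; last exact: ext_in.
  by rewrite yE; apply: ext_dir; exists y.
exact.
Qed.

Lemma ext_secp g xi n : ext N g -> ext N (ray_section g xi n).
Proof. by move=> Eg; elim: n => //= n; exact: ext_section. Qed.

Lemma N_secp g xi n : N g -> N (ray_section g xi n).
Proof. by move=> Ng; elim: n => //= n; exact: NS. Qed.

Lemma directedV g : directed N g -> directed N g^-1.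
Proof.
move=> [x xE xN]; exists (act g x); first by rewrite ss_secV xE.
move=> y yx; rewrite -(ss_actVK g y) ss_secV; apply/NV/xN.
by apply: contraNneq yx => <-; rewrite ss_actVK.
Qed.

Lemma ext_inv g : ext N g -> ext N g^-1.
Proof.
elim=> {}g; first by move=> /NV; exact: ext_in.
  by move=> /directedV; exact: ext_dir.
move=> _ IH; apply: ext_sec => x; rewrite -(ss_actVK g x) ss_secV; exact: IH.
Qed.

(** The section of [g * h] at the loop letter [x] is [g] times a section of [h] along the constant
    ray at [act g x]. After [K] steps that section of [h] no longer changes, and the product is
    itself directed; all other sections met on the way lie in [N]. *)
Lemma ext_dirN g h : directed N g -> N h -> ext N (g * h).
Proof.
move=> [x xE xN] Nh; have [K hK] := good_uec gN Nh.
pose xi := (fun _ : nat => act g x).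
have : sec (ray_section h xi K) (act g x) = ray_section h xi K by apply: (hK 0%N) => // k _.
elim: K h Nh {hK} => [|K IH] h Nh hE.
  apply: ext_dir; exists x; rewrite ?ss_secM ?xE.
    by rewrite [sec h _]hE.
  by move=> y yx; rewrite ss_secM; apply: NM; [exact: xN|exact: NS].
apply: ext_sec => y; rewrite ss_secM; have [->|yx] := eqVneq y x.
  rewrite xE; apply: IH; first exact: NS.
  by move: hE; rewrite (secpS _ _ K).
by apply: ext_in; apply: NM; [exact: xN|exact: NS].
Qed.

Lemma ext_Ndir g h : N g -> directed N h -> ext N (g * h).
Proof.
move=> Ng hD; rewrite -[g * h]invgK invgM; apply: ext_inv.
by apply: ext_dirN; [exact: directedV|exact: NV].
Qed.

(** If [g] moves its loop letter to that of [h], the product is directed at the same letter.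
    Otherwise no letter meets both loops, and each section of the product has at most one directed
    factor. *)
Lemma ext_dirdir g h : directed N g -> directed N h -> ext N (g * h).
Proof.
move=> gD hD; have [x xE xN] := gD; have [z zE zN] := hD.
have secN y : y != x -> ext N (sec (g * h) y).
  move=> yx; rewrite ss_secM; have [->|gyz] := eqVneq (act g y) z.
    by rewrite zE; apply: ext_Ndir => //; exact: xN.
  by apply/ext_in/NM; [exact: xN|exact: zN].
have [gxz|gxz] := eqVneq (act g x) z.
  apply: ext_dir; exists x; first by rewrite ss_secM xE gxz zE.
  move=> y yx; rewrite ss_secM; apply: NM; first exact: xN.
  by apply: zN; rewrite -gxz (inj_eq (can_inj (ss_actK g))).
apply: ext_sec => y; have [->|] := eqVneq y x; last exact: secN.
by rewrite ss_secM xE; apply: ext_dirN => //; exact: zN.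
Qed.

Lemma ext_mul g h : ext N g -> ext N h -> ext N (g * h).
Proof.
move=> Eg; elim: Eg h => {}g; last first.
  by move=> _ IH h Eh; apply: ext_sec => x; rewrite ss_secM; apply/IH/ext_section.
- move=> gD h Eh; elim: Eh g gD => {}h; last first.
    move=> Eh IH g gD; have [x xE xN] := gD.
    apply: ext_sec => y; rewrite ss_secM; have [->|/xN] := eqVneq y x.
      by rewrite xE; exact: IH.
    move: (sec g y) (act g y) => k z Nk; elim: (Eh z) k Nk => {}h' .
    + by move=> Nh k Nk; apply/ext_in/NM.
    + by move=> hD k Nk; exact: ext_Ndir.
    + move=> _ IH' k Nk; apply: ext_sec => w.
      by rewrite ss_secM; apply/IH'/NS.
  + by move=> hD g gD; exact: ext_dirdir.
  + by move=> Nh g gD; exact: ext_dirN.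
- move=> Ng h Eh; elim: Eh g Ng => {}h.
  + by move=> Nh k Nk; apply/ext_in/NM.
  + by move=> hD k Nk; exact: ext_Ndir.
  + by move=> _ IH' k Nk; apply: ext_sec => w; rewrite ss_secM; apply/IH'/NS.
Qed.

(** Along a ray the section remains [g] as long as the letters are [x]. The first other letter leads
    to one of finitely many elements of [N], so a common [K] exists, and one more position pays for
    that letter. *)
Lemma directed_uec g : directed N g -> exists K, stabilizes K g.
Proof.
move=> [x xE xN].
have [K KP] : exists K, forall y, y != x -> stabilizes K (sec g y).
  apply: max_bound => [y m n mn yK /yK|y]; first exact: uec_le.
  have [->|/xN/(good_uec gN) [K yK]] := eqVneq y x; first by exists 0%N.
  by exists K.
exists K.+1 => n; elim: n => [|n IH] xi xiC k nk.
  have [x0|x0] := eqVneq (xi 0%N) x.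
    have sg l : ray_section g xi l = g by elim: l => //= l ->; rewrite xiC // x0.
    by rewrite !sg.
  case: k nk => // k nk; rewrite (secpS g xi k.+1) (secpS g xi k).
  apply: (KP _ x0 0%N) => // l _; by rewrite /ray_shift !xiC.
case: k nk => [|k] nk; first by rewrite addnS in nk.
rewrite (secpS g xi k.+1) (secpS g xi k); have [x0|x0] := eqVneq (xi 0%N) x.
  by rewrite x0 xE; apply: IH => //; exact: tailc_ray_shift.
apply: (KP _ x0 n); first exact: tailc_ray_shift.
by move: nk; rewrite addSn ltnS; apply: leq_trans; rewrite leq_add2l.
Qed.

Lemma ext_uec g : ext N g -> exists K, stabilizes K g.
Proof.
elim=> {}g; [exact: good_uec|exact: directed_uec|move=> _ IH].
have [K KP] : exists K, forall x, stabilizes K (sec g x).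
  by apply: max_bound => // x m n; exact: uec_le.
by exists K.+1; exact: uec_sec.
Qed.

Lemma ext_good : section_group (ext N).
Proof.
split; [split| | |].
- exact: ext_in.
- exact: ext_mul.
- exact: ext_inv.
- by move=> g x; exact: ext_section.
- exact: ext_sec.
- exact: ext_uec.
Qed.

(** This identifies the possible germs: an element of [ext N] equal to its section at [x] is
    directed at [x]. If it were directed at another letter [z], its section at [x], which is the
    element itself, would lie in [N]. *)
Lemma ext_fixed_off g x : ext N g -> sec g x = g ->
  forall y, y != x -> N (sec g y).
Proof.
move=> Eg; elim: Eg x => {}g.
- by move=> Ng x _ y _; exact: NS.
- move=> [z zE zN] x xE y yx; have [xz|/zN] := eqVneq x z.
    by apply: zN; rewrite -xz.
  by rewrite xE; exact: NS.
- move=> _ IH x xE y yx; rewrite -xE; apply: IH yx.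
  by rewrite xE.
Qed.

End Ext.

Fixpoint finn n : set G :=
  if n is k.+1 then fun g => forall x, finn k (sec g x) else fun g => g = 1.

Definition finitary : set G := fun g => exists n, finn n g.

Lemma finn1 n : finn n 1.
Proof. by elim: n => //= n IH x; rewrite ss_sec1. Qed.

Lemma finnS n g : finn n g -> finn n.+1 g.
Proof.
by elim: n g => [g -> x|n IH g gn x]; [rewrite ss_sec1|exact: IH].
Qed.

Lemma finn_le m n g : (m <= n)%N -> finn m g -> finn n g.
Proof.
by move=> /subnK <-; elim: (n - m)%N => // k IH /IH; exact: finnS.
Qed.

Lemma finn_sgp n : is_subgroup (finn n).
Proof.
split; first exact: finn1.
  elim: n => [x y -> ->|n IH g h gn hn x]; first by rewrite mulg1.
  by rewrite ss_secM; exact: IH.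
elim: n => [x ->|n IH g gn x]; first by rewrite /= invg1.
by rewrite -(ss_actVK g x) ss_secV; exact: IH.
Qed.

Lemma finn_uec n g : finn n g -> stabilizes n g.
Proof.
elim: n g => [g ->|n IH g gn]; first by move=> n xi _ k _; rewrite !secp1.
by apply: uec_sec => x; exact: IH.
Qed.

Lemma finitary_good : section_group finitary.
Proof.
split; first split.
- by exists 0%N.
- move=> g h [m gm] [n hn]; exists (maxn m n).
  by case: (finn_sgp (maxn m n)) => _ + _; apply;
    [apply: finn_le gm; exact: leq_maxl|apply: finn_le hn; exact: leq_maxr].
- by move=> g [n gn]; exists n; case: (finn_sgp n) => _ _; apply.
- by move=> g x [n gn]; exists n; apply: (finnS gn).
- move=> g gF; have [n gn] : exists n, forall x, finn n (sec g x).
    by apply: max_bound => // x m n; exact: finn_le.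
  by exists n.+1.
- by move=> g [n gn]; exists n; exact: finn_uec.
Qed.

Variable R : realType.

(** The action on letters maps [H] to a finite group. On the kernel, each section map is a
    homomorphism, so the sections at the letters of [P] can be killed one at a time through
    [amen_hom], until only 1 remains. [P] allows a letter whose section is outside [N] to be left
    out. *)
Lemma amen_sections (H N : set G) (P : pred B) :
  is_subgroup H -> mean_amenable R N ->
  (forall g y, H g -> P y -> (forall x, act g x = x) -> N (sec g y)) ->
  (forall g, H g -> (forall x, act g x = x) -> (forall y, P y -> sec g y = 1) ->
     g = 1) ->
  mean_amenable R H.
Proof.
move=> sH aN HN HE; have [H1 HM HV] := sH.
have ainj g : injective (act g) := can_inj (ss_actK g).
pose f g := perm (ainj g).
have fE g : f g = 1%g <-> forall x, act g x = x.
  split=> [fg x|gx]; last by apply/permP => x; rewrite permE perm1 gx.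
  by rewrite -(permE (ainj g)) -/(f g) fg perm1.
apply: (amen_hom (N := [set: {perm B}]) (f := f)) => //.
- by move=> g h _ _; apply/permP => x; rewrite permM !permE ss_actM.
- by apply/fE => x; exact: ss_act1.
- exact: amen_finite.
pose K (s : seq B) := [set g | [/\ H g, forall x, act g x = x &
  forall y, y \in s -> P y -> sec g y = 1]].
have KS s : is_subgroup (K s).
  split.
  - by split=> // [x|y _ _]; rewrite ?ss_act1 ?ss_sec1.
  - move=> g h [Hg ag sg] [Hh ah sh]; split; first exact: HM.
      by move=> x; rewrite ss_actM ag ah.
    by move=> y ys Py; rewrite ss_secM ag sg // sh // mulg1.
  - move=> g [Hg ag sg]; split; first exact: HV.
      by move=> x; rewrite -{1}(ag x) ss_actK.
    by move=> y ys Py; rewrite -{1}(ag y) ss_secV sg // invg1.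
have Kenum : mean_amenable R (K (enum B)).
  apply: amen_unit => // g [Hg ag sg]; apply: HE => // y Py.
  by apply: sg => //; rewrite mem_enum.
suff /(_ (enum B) [::] erefl) : forall s t, t ++ s = enum B -> mean_amenable R (K t).
  by apply: eq_amen => g; split=> [[Hg /fE]|[Hg /fE]].
elim=> [t|y s IH t tE]; first by rewrite cats0 => ->.
have {}IH : mean_amenable R (K (rcons t y)) by apply: IH; rewrite cat_rcons.
have [Py|nPy] := boolP (P y); last first.
  apply: eq_amen IH => g; split=> -[Hg ag sg]; split=> // z.
    by move=> zt; apply: sg; rewrite mem_rcons inE zt orbT.
  by rewrite mem_rcons inE => /predU1P[->|]; [rewrite (negbTE nPy)|exact: sg].
apply: (amen_hom (f := fun g => sec g y) (KS t) _ _ _ aN).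
- by move=> g h [_ ag _] _; rewrite ss_secM ag.
- exact: ss_sec1.
- by move=> g [Hg ag _]; exact: HN.
apply: eq_amen IH => g; split=> [[Hg ag sg]|[[Hg ag sg] yE]].
  split; last by apply: sg => //; rewrite mem_rcons mem_head.
  by split=> // z zt; apply: sg; rewrite mem_rcons inE zt orbT.
split=> // z; rewrite mem_rcons inE => /predU1P[->//|]; exact: sg.
Qed.

Lemma amen_finn n : mean_amenable R (finn n).
Proof.
elim: n => [|n IH]; first by apply: amen_unit => //; exact: finn_sgp.
apply: (amen_sections (N := finn n) (P := predT)) => //; first exact: finn_sgp.
move=> g _ ag sg.
(* The pair of 1 and [g] is stable under sections and acts trivially on letters. *)
apply: (ss_faithful (s := S) (P := fun h => h = 1 \/ (h = g))); last by right.
move=> h [->|->] x; first by rewrite ss_act1 ss_sec1; split=> //; left.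
by rewrite ag sg //; split=> //; left.
Qed.

(** The group is the increasing union of the [finn n], and an element of [finn k] preserves the mean
    of [finn n] for all [n >= k]; an ultralimit of these means is invariant. *)
Lemma amen_finitary : mean_amenable R finitary.
Proof.
have /choice [M MP] := amen_finn.
have MT n : mean setT (M n) := mean_sub (@subsetT _ _) (MP n).1.
have [m [mT m0 mE]] := mean_ultralimit eventually_filter MT.
exists m; split.
  apply: mean_carrier mT _ => u bu u0; apply: m0 => //; exists 0%N => // n _.
  by apply: (mean_ge0 (MP n).1) => // x xn; apply: u0; exists n.
move=> h u [k hk] bu; apply: mE => // [|e e0]; first exact: bnd_comp.
exists k => // n kn /=; rewrite (MP n).2 ?subrr ?normr0 ?ltW //.
exact: finn_le hk.
Qed.

End SelfSimilar.

(** * Germs along eventually constant rays *)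

Section Germs.
Local Open Scope classical_set_scope.
Local Open Scope group_scope.
Variables (G : groupType) (B : finType) (S : self_similar G B).
Variables (N : set G) (gN : section_group S N).
Implicit Types (g h : G) (x y : B) (xi : nat -> B).
Local Notation act := (ss_act S).
Local Notation sec := (ss_sec S).
Local Notation ray_section := (ray_section S).
Local Notation rayact := (ray_act S).
Local Notation E := (ext S N).

Let gE : section_group S E. Proof. exact: ext_good. Qed.
Let E1 : E 1. Proof. by case: (good_sgp gE). Qed.
Let EM g h : E g -> E h -> E (g * h).
Proof. by case: (good_sgp gE) => _ + _; apply. Qed.
Let EV g : E g -> E g^-1.
Proof. by case: (good_sgp gE) => _ _; apply. Qed.
Let N1 : N 1. Proof. by case: (good_sgp gN). Qed.
Let NM g h : N g -> N h -> N (g * h).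
Proof. by case: (good_sgp gN) => _ + _; apply. Qed.
Let NV g : N g -> N g^-1.
Proof. by case: (good_sgp gN) => _ _; apply. Qed.

Definition tail xi x := exists n, forall k, (n <= k)%N -> xi k = x.

Lemma tail_uniq xi x y : tail xi x -> tail xi y -> x = y.
Proof.
move=> [m mx] [n nx]; rewrite -(mx (maxn m n)) ?leq_maxl //.
by rewrite nx ?leq_maxr.
Qed.

Lemma tail_tailc xi x : tail xi x -> exists n, const_from n xi.
Proof. by move=> [n nx]; exists n => k nk; rewrite !nx. Qed.

(* The sections of [g] along [xi] are eventually constant for the elements used
   here, so the germ is represented by their limit. *)
Definition germ g xi : G :=
  if pselect (exists x, tail xi x) then
    xget 1 [set a | exists n, forall k, (n <= k)%N -> ray_section g xi k = a]
  else 1.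

Lemma germE g xi x a n : tail xi x ->
  (forall k, (n <= k)%N -> ray_section g xi k = a) -> germ g xi = a.
Proof.
move=> xix aE; rewrite /germ; case: pselect => [xi_tail|[]]; last by exists x.
case: xgetP => [b bx [m bE]|aN]; last by case: (aN a); exists n.
by rewrite -(bE (maxn m n)) ?leq_maxl // aE // leq_maxr.
Qed.

Lemma germP g xi x : E g -> tail xi x ->
  exists n, forall k, (n <= k)%N -> ray_section g xi k = germ g xi.
Proof.
move=> Eg xix; have [n xin] := tail_tailc xix.
have [K gK] := ext_uec gN Eg.
suff aE k : (n + K <= k)%N -> ray_section g xi k = ray_section g xi (n + K).
  by exists (n + K)%N => k nk; rewrite aE // (germE xix aE).
move=> /subnK <-; elim: (k - (n + K))%N => // i IH.
by rewrite addSn (gK n) // leq_addl.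
Qed.

Lemma germ_ntail g xi : ~ (exists x, tail xi x) -> germ g xi = 1.
Proof. by rewrite /germ; case: pselect. Qed.

Lemma rayact_tail g xi x : E g -> tail xi x ->
  sec (germ g xi) x = germ g xi /\ tail (rayact g xi) (act (germ g xi) x).
Proof.
move=> Eg xix; have [n aE] := germP Eg xix; have [m mx] := xix; split.
  rewrite -{2}(aE (maxn m n).+1); last by rewrite ltnW // ltnS leq_maxr.
  by rewrite /= mx ?leq_maxl // aE // leq_maxr.
exists (maxn m n) => k; rewrite geq_max => /andP[mk nk].
by rewrite /ray_act aE // mx.
Qed.

Lemma rayact_ntail g xi : E g -> ~ (exists x, tail xi x) ->
  ~ (exists x, tail (rayact g xi) x).
Proof.
move=> Eg nxi [x /(rayact_tail (EV Eg)) [_]]; rewrite rayactK => gxi.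
by apply: nxi; eexists; exact: gxi.
Qed.

Lemma germ_1 xi : germ 1 xi = 1.
Proof.
have [[x xix]|nxi] := pselect (exists x, tail xi x); last exact: germ_ntail.
by apply: (germE (n := 0%N) xix) => k _; rewrite secp1.
Qed.

Lemma germM g h xi : E g -> E h ->
  germ (g * h) xi = germ g xi * germ h (rayact g xi).
Proof.
move=> Eg Eh; have [[x xix]|nxi] := pselect (exists x, tail xi x); last first.
  by rewrite !germ_ntail ?mulg1 //; exact: rayact_ntail.
have [m mE] := germP Eg xix; have [_ gxi] := rayact_tail Eg xix.
have [n nE] := germP Eh gxi; apply: (germE (n := maxn m n) xix) => k.
by rewrite geq_max => /andP[mk nk]; rewrite secpM mE // nE.
Qed.

Lemma germ_section g xi : E g -> germ g xi = germ (sec g (xi 0%N)) (ray_shift xi).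
Proof.
move=> Eg; have [[x xix]|nxi] := pselect (exists x, tail xi x); last first.
  rewrite !germ_ntail // => -[x [n nx]]; apply: nxi; exists x, n.+1.
  by move=> [|k]// /nx.
have [n nE] := germP Eg xix.
have sxi : tail (ray_shift xi) x.
  by have [m mx] := xix; exists m => k mk; apply: mx; exact: leqW.
apply/esym/(germE (n := n) sxi) => k nk.
by rewrite -secpS nE // leqW.
Qed.

Lemma germ_ext g xi : E g -> E (germ g xi).
Proof.
move=> Eg; have [[x xix]|nxi] := pselect (exists x, tail xi x); last first.
  by rewrite germ_ntail.
by have [n nE] := germP Eg xix; rewrite -(nE n) //; exact: ext_secp.
Qed.

Lemma germ_N g xi n : E g -> N (ray_section g xi n) -> N (germ g xi).
Proof.
move=> Eg Ng; have [[x xix]|nxi] := pselect (exists x, tail xi x); last first.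
  by rewrite germ_ntail.
have [m mE] := germP Eg xix; rewrite -(mE (n + m)%N) ?leq_addl //.
by rewrite secpD; exact: N_secp.
Qed.

Lemma germ_off g xi x : E g -> sec g x = g -> ~ (forall n, xi n = x) ->
  N (germ g xi).
Proof.
move=> Eg gx nxi.
have [n nx] : exists n, xi n != x.
  by apply: contra_notP nxi => /forallNP nx n; apply/eqP/negPn/negP; exact: nx.
have [{}n {}nx nmin] := ex_minnP (P := fun n => xi n != x) (ex_intro _ n nx).
have nE k : (k <= n)%N -> ray_section g xi k = g.
  elim: k => //= k IH kn; rewrite IH ?(ltnW kn) //.
  have -> : xi k = x; last by [].
  by apply/eqP; apply: contraLR kn => /nmin; rewrite -leqNgt.
apply: (@germ_N _ _ n.+1) => //=; rewrite nE //.
exact: (ext_fixed_off gN) gx _ nx.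
Qed.

(** Modulo [N], a directed element has a nontrivial germ only at the constant ray of its loop
    letter, and each passage to sections adds one letter in front. As finitely many rays are
    constant from [n], the singular rays are finite in number. *)
Lemma germ_singular g : E g -> exists n, forall xi, ~ N (germ g xi) -> const_from n xi.
Proof.
elim=> {}g.
- move=> Ng; exists 0%N => xi []; apply: (@germ_N _ _ 0%N) => //.
  exact: ext_in.
- move=> gD; exists 0%N => xi nN; have [x xE _] := gD.
  have xix : forall n, xi n = x.
    by apply: contra_notP nN; apply: germ_off => //; exact: ext_dir.
  by move=> k _; rewrite !xix.
move=> Es IH.
have [n nP] := max_bound (P := fun x n => forall xi, ~ N (germ (sec g x) xi) -> const_from n xi)
  (fun x m n mn H xi nN => tailc_le mn (H xi nN)) IH.
exists n.+1 => xi; rewrite germ_section; last exact: ext_sec.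
by move=> /nP nxi [|k]//; exact: nxi.
Qed.

(** Germs are faithful modulo [N]: a directed element is its own germ at the constant ray of its
    loop letter, and [good_full] carries the conclusion up from the sections. *)
Lemma germ_uniq g : E g -> (forall xi, N (germ g xi)) -> N g.
Proof.
elim=> {}g //.
- move=> gD; have [x xE _] := gD => /(_ (fun=> x)).
  rewrite (@germE _ _ x g 0%N) //; first by exists 0%N.
  by elim=> //= k -> //; rewrite xE.
move=> Es IH Ng; apply: (good_full gN) => x; apply: IH => xi.
by have := Ng (ray_cons x xi); rewrite germ_section //; exact: ext_sec.
Qed.

(** The constraint at a tail letter is the one that germs satisfy by [rayact_tail]. *)
Definition fiber xi : set G :=
  [set b | [/\ E b, forall x, tail xi x -> sec b x = b &
    ~ (exists x, tail xi x) -> N b]].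

Definition admissible (z : (nat -> B) -> G) :=
  (forall xi, fiber xi (z xi)) /\
  exists n, forall xi, ~ N (z xi) -> const_from n xi.

(** At level 0 the element with section [z (fun=> x)] at each letter [x] works: that section is its
    own germ at the constant ray, and its other germs lie in [N] by [germ_off]. At higher levels,
    elements solving the problem for the families [z (ray_cons x _)] are assembled by
    [ss_portrait]. *)
Lemma germ_exists z : admissible z ->
  exists2 g, E g & forall xi, N ((germ g xi)^-1 * z xi).
Proof.
move=> [zQ [n zn]]; elim: n z zQ zn => [|n IH] z zQ zn.
  have [g gP] := ss_portrait S (fun x => z (fun=> x)).
  have Eg : E g by apply: ext_sec => x; rewrite (gP x).2; case: (zQ (fun=> x)).
  exists g => // xi; rewrite germ_section // (gP _).2; set x := xi 0%N.
  have [Ea /(_ x) ax _] := zQ (fun=> x).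
  have {}ax : sec (z (fun=> x)) x = z (fun=> x) by apply: ax; exists 0%N.
  have [xi0|nxi] := pselect (const_from 0 xi).
    have xiE : xi = fun=> x by apply/funext => k; rewrite xi0.
    rewrite (@germE _ _ x (z (fun=> x)) 0%N); first by rewrite xiE mulVg.
      by exists 0%N => k _; rewrite /ray_shift xi0.
    by elim=> //= k -> //; rewrite /ray_shift xi0.
  apply: NM; last by apply: contra_notP nxi => /zn.
  apply/NV/(germ_off Ea ax); apply: contra_not nxi => sxi.
  by move=> [|k] // _; exact: sxi.
have /choice [f fP] x : exists g, E g /\
    forall xi, N ((germ g xi)^-1 * z (ray_cons x xi)).
  have [|xi /zn|g Eg gP] := IH (fun xi => z (ray_cons x xi)); last by exists g.
    move=> xi; have [Ez zx zN] := zQ (ray_cons x xi); split=> // [y [k yk]|nxi].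
      by apply: zx; exists k.+1 => -[|i] // ki; exact: yk.
    by apply: zN => -[y [k yk]]; apply: nxi; exists y, k => i ki; exact: (yk i.+1 (leqW ki)).
  exact: tailc_ray_shift.
have [g gP] := ss_portrait S f.
have Eg : E g by apply: ext_sec => x; rewrite (gP x).2; case: (fP x).
exists g => // xi; rewrite germ_section // (gP _).2.
by have := (fP (xi 0%N)).2 (ray_shift xi); rewrite ray_cons_shift.
Qed.

Variable R : realType.

Definition isotropy x : set G := [set a | [/\ E a, sec a x = a & act a x = x]].

(** The letters other than [x] have sections in [N] by [ext_fixed_off]. The section at [x] is the
    element itself, so it can be left out: once the other sections and the action on letters are
    trivial, faithfulness forces the element to be 1. *)
Lemma isotropy_amen x : mean_amenable R N -> mean_amenable R (isotropy x).
Proof.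
move=> aN; apply: (amen_sections (S := S) (N := N) (P := fun y => y != x)) => //.
- split; first by split; rewrite ?ss_sec1 ?ss_act1.
    move=> g h [Eg gx gxx] [Eh hx hxx]; split; first exact: EM.
      by rewrite ss_secM gxx gx hx.
    by rewrite ss_actM gxx.
  move=> g [Eg gx gxx]; split; first exact: EV.
    by have := ss_secV S g x; rewrite gxx gx.
  by have := ss_actK S g x; rewrite gxx.
- by move=> g y [Eg gx _] yx _; exact: (ext_fixed_off gN) gx _ yx.
move=> g [Eg gx _] ag sg.
apply: (ss_faithful (s := S) (P := fun h => h = 1 \/ h = g)); last by right.
move=> h [->|->] y; first by rewrite ss_act1 ss_sec1; split=> //; left.
rewrite ag; split=> //; have [->|/sg] := eqVneq y x; first by rewrite gx; right.
by left.
Qed.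

(** The orbits of letters under the groupoid of germs. *)
Definition connected x : pred B :=
  fun y => `[< exists a, [/\ E a, sec a x = a & act a x = y] >].

Lemma connected_act a x : E a -> sec a x = a ->
  connected (act a x) =1 connected x.
Proof.
move=> Ea ax y; apply/asboolP/asboolP => -[b [Eb bx by_]].
  exists (a * b); split; first exact: EM.
    by rewrite ss_secM ax bx.
  by rewrite ss_actM.
exists (a^-1 * b); split; first by apply: EM => //; exact: EV.
  by rewrite ss_secM ss_secV ax ss_actK bx.
by rewrite ss_actM ss_actK.
Qed.

(** As in [amen_action], but for a groupoid: the mean of the isotropy group at the representative
    [r x] of an orbit is transported by a chosen germ [w x] from [x] to [r x]. Another choice
    differs by an isotropy element, which yields equivariance. *)
Lemma letter_means : mean_amenable R N -> exists q : B -> (G -> R) -> R,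
  (forall x, mean [set b | E b /\ sec b x = b] (q x)) /\
  forall a x u, E a -> sec a x = a -> bounded_fct u ->
    q (act a x) (fun b => u (a * b)) = q x u.
Proof.
move=> aN; have /choice [n nP] x := isotropy_amen x aN.
pose r x := odflt x [pick y | connected x y].
have rP x : connected x (r x).
  rewrite /r; case: pickP => //= /(_ x) /asboolP []; exists 1.
  by rewrite ss_sec1 ss_act1.
have rE a x : E a -> sec a x = a -> r (act a x) = r x.
  move=> Ea ax; rewrite /r -(eq_pick (connected_act Ea ax)); case: pickP => //=.
  by move=> /(_ (act a x)); rewrite connected_act // => /asboolP []; exists a.
have /choice [w wP] x : exists a, [/\ E a, sec a x = a & act a x = r x].
  by apply/asboolP; exact: rP.
exists (fun x u => n (r x) (fun b => u (w x * b))); split=> [x|a x u Ea ax bu].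
  have [Ew wx wr] := wP x.
  apply: (mean_image (f := fun b => w x * b) (nP (r x)).1) => b [Eb bx _].
  by split; [exact: EM|rewrite ss_secM wx wr bx].
have [Ew wx wr] := wP x; have [Ev vx vr] := wP (act a x).
rewrite rE //; rewrite rE // in vr.
rewrite -[RHS]((nP (r x)).2 ((w x)^-1 * a * w (act a x))).
- by congr n; apply/funext => b; rewrite !mulgA mulgV mul1g.
- split.
  + by apply: EM => //; apply: EM => //; exact: EV.
  + have := ss_secV S (w x) x; have := ss_actK S (w x) x; rewrite wr => aV sV.
    by rewrite !ss_secM ss_actM sV wx aV ax vx.
  + by have := ss_actK S (w x) x; rewrite wr => aV; rewrite !ss_actM aV.
- exact: bnd_comp.
Qed.

(** At a ray with a tail the mean depends only on the tail letter. Other rays have trivial germs and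
    carry the Dirac mean at 1. *)
Lemma fiber_means : mean_amenable R N -> exists q : (nat -> B) -> (G -> R) -> R,
  (forall xi, mean (fiber xi) (q xi)) /\
  forall g xi u, E g -> bounded_fct u ->
    q (rayact g xi) (fun b => u (germ g xi * b)) = q xi u.
Proof.
move=> /letter_means [q [qM qE]].
have /choice [r rP] xi : exists r : (G -> R) -> R,
    (forall x, tail xi x -> r = q x) /\
    (~ (exists x, tail xi x) -> r = fun u => u 1).
  have [[x xix]|nxi] := pselect (exists x, tail xi x).
    exists (q x); split=> [y yx|[]]; last by exists x.
    by rewrite (tail_uniq xix yx).
  by exists (fun u => u 1); split=> // x xix; case: nxi; exists x.
exists r; split=> [xi|g xi u Eg bu].
  have [[x xix]|nxi] := pselect (exists x, tail xi x).
    rewrite ((rP xi).1 _ xix); apply: mean_sub (qM x) => b /= [Eb bx].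
    by split=> // [y /(tail_uniq xix) <-|[]] //; exists x.
  rewrite ((rP xi).2 nxi); apply: mean_dirac; split=> // x xix.
  by case: nxi; exists x.
have [[x xix]|nxi] := pselect (exists x, tail xi x).
  have [gx gxi] := rayact_tail Eg xix.
  by rewrite ((rP xi).1 _ xix) ((rP _).1 _ gxi) qE //; exact: germ_ext.
rewrite ((rP xi).2 nxi) ((rP _).2 (rayact_ntail Eg nxi)) germ_ntail //.
by rewrite mulg1.
Qed.

End Germs.

(** * Co-amenability of the base group *)

Section Coamenable.
Local Open Scope classical_set_scope.
Local Open Scope group_scope.
Variables (G : groupType) (B : finType) (S : self_similar G B).
Variables (N : set G) (gN : section_group S N) (R : realType).
Implicit Types (g h : G) (xi : nat -> B) (z : (nat -> B) -> G).
Local Notation rayact := (ray_act S).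
Local Notation E := (ext S N).
Local Notation germ := (germ S).
Local Notation fiber := (fiber S N).
Local Notation admissible := (admissible S N).

Let gE : section_group S E. Proof. exact: ext_good. Qed.
Let E1 : E 1. Proof. by case: (good_sgp gE). Qed.
Let EM g h : E g -> E h -> E (g * h).
Proof. by case: (good_sgp gE) => _ + _; apply. Qed.
Let EV g : E g -> E g^-1.
Proof. by case: (good_sgp gE) => _ _; apply. Qed.
Let N1 : N 1. Proof. by case: (good_sgp gN). Qed.
Let NM g h : N g -> N h -> N (g * h).
Proof. by case: (good_sgp gN) => _ + _; apply. Qed.
Let NV g : N g -> N g^-1.
Proof. by case: (good_sgp gN) => _ _; apply. Qed.

Definition upd z xi b : (nat -> B) -> G := fun eta => if eta == xi then b else z eta.

(** By [germM], this turns the germs of [h] into those of [g * h]: it is left multiplication read on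
    families of germs. *)
Definition twist g z : (nat -> B) -> G := fun xi => germ g xi * z (rayact g xi).

Lemma upd_admissible z xi b : admissible z -> fiber xi b -> admissible (upd z xi b).
Proof.
move=> [zQ [n zn]] bQ; split.
  by move=> eta; rewrite /upd; case: eqP => [->|].
have [[m xim]|nxi] := pselect (exists m, const_from m xi).
  exists (maxn m n) => eta; rewrite /upd; case: eqP => [-> _|_ /zn].
    by apply: tailc_le xim; exact: leq_maxl.
  by apply: tailc_le; exact: leq_maxr.
exists n => eta; rewrite /upd; case: eqP => [-> []|_ /zn//].
by case: bQ => _ _; apply=> -[x /tail_tailc].
Qed.

Lemma one_admissible : admissible (fun=> 1).
Proof.
by split=> [xi|]; [split=> // x _; rewrite ss_sec1|exists 0%N => xi []].
Qed.

Lemma twist_upd g z xi b :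
  twist g (upd z xi b) =
  upd (twist g z) (rayact g^-1 xi) (germ g (rayact g^-1 xi) * b).
Proof.
apply/funext => eta; rewrite /twist /upd -(can2_eq (rayactK S g) (rayactVK S g)).
by case: eqP => // <-; rewrite rayactK.
Qed.

Section IteratedMeans.
Variable q : (nat -> B) -> (G -> R) -> R.
Hypothesis qM : forall xi, mean (fiber xi) (q xi).
Hypothesis qE : forall g xi u, E g -> bounded_fct u ->
  q (rayact g xi) (fun b => u (germ g xi * b)) = q xi u.

Let qT xi : mean setT (q xi) := mean_sub (@subsetT _ _) (qM xi).

Fixpoint itmean (s : seq (nat -> B)) z (V : ((nat -> B) -> G) -> R) : R :=
  if s is xi :: s' then q xi (fun b => itmean s' (upd z xi b) V) else V z.

Lemma itmean_meanT s z : mean setT (itmean s z).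
Proof.
elim: s z => [z|xi s IH z] /=; first exact: mean_dirac.
exact: (mean_bind (n := fun b => itmean s (upd z xi b)) (qT xi)).
Qed.

Lemma itmean_mean s z : admissible z -> mean admissible (itmean s z).
Proof.
elim: s z => [z|xi s IH z] za /=; first exact: mean_dirac.
apply: (mean_bind (n := fun b => itmean s (upd z xi b)) (qM xi)).
  by move=> b; exact: itmean_meanT.
by move=> b bQ; apply: IH; exact: upd_admissible.
Qed.

Lemma bnd_itmean T (f : T -> (nat -> B) -> G) s V :
  bounded_fct V -> bounded_fct (fun b => itmean s (f b) V).
Proof.
move=> [C VC]; apply: (bnd_mean (n := fun b => itmean s (f b)) (u := fun=> V)).
  by move=> b; exact: itmean_meanT.
by exists C.
Qed.

Lemma itmean_twist g s z V : E g -> bounded_fct V ->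
  itmean s z (fun z => V (twist g z)) =
  itmean (map (rayact g^-1) s) (twist g z) V.
Proof.
move=> Eg bV; elim: s z => //= xi s IH z.
rewrite -[RHS](qE _ Eg); last exact: (bnd_itmean (upd (twist g z) _)).
rewrite rayactVK; congr (q _ _); apply/funext => b.
by rewrite IH twist_upd.
Qed.

(** The values of [z] at the rays of [s] are overwritten, so only those off [s] matter. Once [s]
    contains the singular rays of [g], the starting families 1 and [twist g 1] are thus
    indistinguishable. *)
Lemma itmean_congr s z z' V :
  (forall z z', (forall xi, N ((z xi)^-1 * z' xi)) -> V z = V z') ->
  (forall xi, xi \notin s -> N ((z xi)^-1 * z' xi)) -> itmean s z V = itmean s z' V.
Proof.
move=> VN; elim: s z z' => [|xi s IH] z z' zz' /=.
  by apply: VN => xi; exact: zz'.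
congr (q _ _); apply/funext => b; apply: IH => eta etas; rewrite /upd.
case: eqP => [_|/eqP ne]; first by rewrite mulVg.
by apply: zz'; rewrite inE negb_or ne.
Qed.

End IteratedMeans.

(* Evaluating [germ g] at all rays identifies [E / N] with the admissible
   families modulo [N], so a mean on families that is invariant under [twist]
   yields an invariant mean on [E / N]. *)
Lemma amen_ext (m : (seq (nat -> B) -> R) -> R) :
  (forall n, mean [set s : seq (nat -> B) | forall xi, const_from n xi -> xi \in s] m) ->
  (forall g u, E g -> bounded_fct u -> m (fun s => u (map (rayact g) s)) = m u) ->
  mean_amenable R N -> mean_amenable R E.
Proof.
move=> mT minv aN; have [q [qM qE]] := fiber_means gN aN.
have [n [nN ninv]] := aN.
pose lifts z := [set g | E g /\ forall xi, N ((germ g xi)^-1 * z xi)].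
(* The default 1 serves families with no lift and keeps [gam] in [E]. A lift is unique only up to
   right multiplication by [N], which the average over [N] in [V] absorbs. *)
pose gam z := xget 1 (lifts z).
have gamE z : E (gam z) by rewrite /gam; case: xgetP => [g _ []|].
pose V u z := n (fun h => u (gam z * h)).
have VM : forall z, mean E (fun u => V u z).
  move=> z; apply: (mean_image (f := fun h => gam z * h) nN) => h Nh.
  by apply: EM => //; exact: ext_in.
have bV u : bounded_fct u -> bounded_fct (V u).
  by move=> [C uC]; exists C => z; apply: (mean_norm nN) => h; exact: uC.
(* Families equal modulo [N] have the same set of lifts, hence the same chosen lift. *)
have VN u z z' : (forall xi, N ((z xi)^-1 * z' xi)) -> V u z = V u z'.
  move=> zz'; rewrite /V /gam (_ : lifts z = lifts z') //.
  apply/seteqP; split=> g [Eg gz]; split=> // xi.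
    by have := NM (gz xi) (zz' xi); rewrite mulgA mulgK.
  by have := NM (gz xi) (NV (zz' xi)); rewrite invgM invgK mulgA mulgK.
have Vtwist g u z : E g -> bounded_fct u -> admissible z ->
    V (fun x => u (g * x)) z = V u (twist g z).
  move=> Eg bu za; rewrite /V; have [h0 Eh0 h0z] := germ_exists gN za.
  have [_ gz] : lifts z (gam z).
    by rewrite /gam; case: xgetP => [//|/(_ h0)]; case.
  have [_ tz] : lifts (twist g z) (gam (twist g z)).
    rewrite /gam; case: xgetP => [//|/(_ (g * gam z))]; case; split=> [|xi].
      exact: EM.
    by rewrite (germM gN) // /twist invgM -mulgA mulKg.
  (* Both factors have the germs [twist g z] modulo [N], so [k] lies in [N] by [germ_uniq]. *)
  set k := (gam (twist g z))^-1 * (g * gam z).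
  have Nk : N k.
    apply: (germ_uniq gN) => [|xi]; first by apply: EM; [exact: EV|exact: EM].
    set eta := rayact (gam (twist g z))^-1 xi.
    rewrite (germM gN) //; [|exact: EV|exact: EM].
    have -> : germ (gam (twist g z))^-1 xi = (germ (gam (twist g z)) eta)^-1.
      apply/esym/mulg1_eq; rewrite -(rayactVK S (gam (twist g z)) xi) -/eta.
      by rewrite -(germM gN) ?mulgV ?germ_1 //; exact: EV.
    rewrite -/eta (germM gN) //.
    have := NM (tz eta) (NV (gz (rayact g eta))); rewrite /twist.
    by rewrite invgM invgK !mulgA mulgK.
  rewrite -[RHS](ninv k) //; last exact: bnd_comp.
  by congr n; apply/funext => h; rewrite /k !mulgA mulgV mul1g.
pose J s := itmean q s (fun=> 1).
have JT s : mean setT (J s) := itmean_meanT qM s _.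
exists (fun u => m (fun s => J s (V u))); split.
  apply: (mean_bind (n := fun s u => J s (V u)) (mT 0%N)) => [s|s _].
    apply: (mean_bind (n := fun z u => V u z) (JT s)) => // z.
      exact: mean_sub (@subsetT _ _) (VM z).
    by move=> _; exact: mean_sub (@subsetT _ _) (VM z).
  apply: (mean_bind (n := fun z u => V u z) (JT s)) => // z.
  exact: mean_sub (@subsetT _ _) (VM z).
move=> g u Eg bu.
pose J' s z := itmean q s z (V u).
have bJ f : bounded_fct (fun s => J' s (f s)).
  apply: (bnd_mean (n := fun s => itmean q s (f s)) (u := fun=> V u)).
    by move=> s; exact: itmean_meanT.
  by have [C VC] := bV _ bu; exists C.
(* Equivariance moves [g] from the integrand to the list and the starting family, invariance of [m]
   then removes it from the list, and the starting family can be reset to 1 because the lists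
   carrying [m] contain all singular rays of [g]. *)
transitivity (m (fun s => J' (map (rayact g^-1) s) (twist g (fun=> 1)))).
  congr m; apply/funext => s; rewrite /J' -(itmean_twist qM qE) //; last exact: bV.
  apply: (eq_mean (itmean_mean qM s one_admissible)).
  - by apply: bV; exact: bnd_comp.
  - by apply: bnd_comp; exact: bV.
  - by move=> z za; exact: Vtwist.
rewrite (minv g^-1 (fun s => J' s (twist g (fun=> 1)))) //; last exact: EV.
have [k kP] := germ_singular gN Eg.
apply: (eq_mean (mT k)); [exact: bJ|exact: bJ|move=> s sk].
apply: itmean_congr => [z z'|xi xis]; first exact: VN.
rewrite /twist !mulg1; apply: NV; apply: contrapT => /kP /sk.
exact/negP.
Qed.

End Coamenable.

(** * Random subsequences *)

Section RandomSubsequence.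
Local Open Scope classical_set_scope.
Local Open Scope ring_scope.
Variables (R : realType) (X : eqType).
Implicit Types (p q a b : X -> R) (Y F : seq X) (Phi : seq X -> R).

(* The expectation of [Phi] at the random subsequence of [Y] that keeps each
   entry [x] with weight [p x] and drops it with weight [q x]. *)
Fixpoint rsub p q Y Phi : R :=
  if Y is x :: Y' then
    p x * rsub p q Y' (fun F => Phi (x :: F)) + q x * rsub p q Y' Phi
  else Phi [::].

Lemma eq_rsub p q Y Phi Psi : Phi =1 Psi -> rsub p q Y Phi = rsub p q Y Psi.
Proof. by move=> /funext ->. Qed.

Lemma rsubD p q Y Phi Psi :
  rsub p q Y (fun F => Phi F + Psi F) = rsub p q Y Phi + rsub p q Y Psi.
Proof.
by elim: Y Phi Psi => //= x Y IH Phi Psi; rewrite !IH; ring.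
Qed.

Lemma rsubZ p q Y c Phi : rsub p q Y (fun F => c * Phi F) = c * rsub p q Y Phi.
Proof. by elim: Y Phi => //= x Y IH Phi; rewrite !IH; ring. Qed.

Lemma rsub_mean p q Y : (forall x, 0 <= p x) -> (forall x, 0 <= q x) ->
  (forall x, p x + q x = 1) ->
  mean [set F : seq X | forall x, x \in Y -> q x = 0 -> x \in F] (rsub p q Y).
Proof.
move=> p0 q0 pq; split.
- by elim: Y => //= x Y ->; rewrite !mulr1 pq.
- by move=> u v _ _; exact: rsubD.
- by move=> c u _; exact: rsubZ.
move=> u _; elim: Y u => [u|x Y IH u u0] /=; first by apply.
have [qx|qx] := eqVneq (q x) 0.
  rewrite qx mul0r addr0 mulr_ge0 //; apply: IH => F FY; apply: u0 => y.
  by rewrite !inE => /predU1P[->|yY] qy; rewrite ?eqxx // FY ?orbT.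
apply: addr_ge0; apply: mulr_ge0 => //; apply: IH => F FY; apply: u0 => y.
  by rewrite !inE => /predU1P[->|yY] qy; rewrite ?eqxx // FY ?orbT.
by rewrite inE => /predU1P[->|yY] qy; [rewrite qy eqxx in qx|exact: FY].
Qed.

Lemma rsub_map p q (h k : X -> X) Y Phi : cancel h k ->
  rsub p q Y (fun F => Phi (map h F)) =
  rsub (fun x => p (k x)) (fun x => q (k x)) (map h Y) Phi.
Proof.
move=> hK; elim: Y Phi => //= x Y IH Phi.
by rewrite hK (IH Phi) (IH (fun F => Phi (h x :: F))).
Qed.

Lemma rsub_filter p q (P : pred X) Y Phi :
  (forall x, ~~ P x -> p x = 0) -> (forall x, ~~ P x -> q x = 1) ->
  rsub p q [seq x <- Y | P x] Phi = rsub p q Y Phi.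
Proof.
move=> pP qP; elim: Y Phi => //= x Y IH Phi.
case: ifPn => [_|nPx] /=; first by rewrite !IH.
by rewrite pP // qP // IH; ring.
Qed.

Definition symmetric_fun Phi := forall F F', perm_eq F F' -> Phi F = Phi F'.

Lemma symmetric_fun_cons Phi x :
  symmetric_fun Phi -> symmetric_fun (fun F => Phi (x :: F)).
Proof. by move=> Phis F F' FF'; apply: Phis; rewrite perm_cons. Qed.

Lemma rsub_insert p q x Y Y' Phi : symmetric_fun Phi ->
  rsub p q (Y ++ x :: Y') Phi = rsub p q (x :: Y ++ Y') Phi.
Proof.
elim: Y Phi => //= y Y IH Phi Phis.
rewrite !IH //=; last exact: symmetric_fun_cons.
rewrite (@eq_rsub p q (Y ++ Y') (fun F => Phi [:: y, x & F]) (fun F => Phi [:: x, y & F])).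
  by ring.
by move=> F; apply: Phis; rewrite (perm_catCA [:: y] [:: x] F).
Qed.

Lemma rsub_perm p q Y Y' Phi : symmetric_fun Phi -> perm_eq Y Y' ->
  rsub p q Y Phi = rsub p q Y' Phi.
Proof.
elim: Y Y' Phi => [|x Y IH] Y' Phi Phis YY'.
  by move: YY'; rewrite perm_sym => /perm_nilP ->.
have xY' : x \in Y' by rewrite -(perm_mem YY') mem_head.
case/path.splitPr: xY' YY' => Y1 Y2 YY'.
rewrite rsub_insert //=; move: YY'.
rewrite perm_sym (perm_catCA Y1 [:: x] Y2) /= perm_cons perm_sym => YY'.
by rewrite (IH (Y1 ++ Y2)) ?(IH (Y1 ++ Y2) Phi) //; exact: symmetric_fun_cons.
Qed.

Definition average (T : Type) (s : seq T) (u : T -> R) : R :=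
  (size s)%:R^-1 * \sum_(x <- s) u x.

Lemma average_mean (T : eqType) (s : seq T) : (0 < size s)%N ->
  mean [set x | x \in s] (average s).
Proof.
move=> s0; have n0 : (size s)%:R != 0 :> R by rewrite pnatr_eq0 -lt0n.
split.
- rewrite /average (_ : \sum_(x <- s) 1 = (size s)%:R) ?mulVf //.
  by rewrite big_const_seq count_predT iter_addr_0.
- by move=> u v _ _; rewrite /average big_split mulrDr.
- by move=> c u _; rewrite /average -mulr_sumr mulrCA.
- move=> u _ u0; rewrite /average mulr_ge0 ?invr_ge0 // big_seq.
  by apply: sumr_ge0 => x; exact: u0.
Qed.

(* Iterated means depend on the order of integration, so an invariant mean on
   lists is needed; averaging over all orderings of a random set provides it. *)
Definition symmetrize Phi F := average (permutations F) Phi.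

Lemma symmetrize_sym Phi : symmetric_fun (symmetrize Phi).
Proof.
move=> F F' FF'; have PP := perm_permutations FF'.
by rewrite /symmetrize /average (perm_size PP) (perm_big _ PP).
Qed.

Lemma symmetrize_map (h k : X -> X) Phi F : cancel h k -> cancel k h ->
  symmetrize (fun F => Phi (map h F)) F = symmetrize Phi (map h F).
Proof.
move=> hK kK; have hinj := can_inj hK.
have PP : perm_eq (map (map h) (permutations F)) (permutations (map h F)).
  apply: uniq_perm; rewrite ?permutations_uniq //.
    by rewrite map_inj_uniq ?permutations_uniq //; exact: inj_map.
  move=> F'; rewrite mem_permutations; apply/mapP/idP => [[F1]|F'F].
    by rewrite mem_permutations => FF1 ->; exact: perm_map.
  exists (map k F'); last by rewrite mapK.
  by rewrite mem_permutations -(mapK hK F); exact: perm_map.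
rewrite /symmetrize /average -(perm_size PP) size_map.
by rewrite -(perm_big _ PP) big_map.
Qed.

Lemma rsub_sym_mean p q Y : (forall x, 0 <= p x) -> (forall x, 0 <= q x) ->
  (forall x, p x + q x = 1) ->
  mean [set F : seq X | forall x, x \in Y -> q x = 0 -> x \in F]
    (fun Phi => rsub p q Y (symmetrize Phi)).
Proof.
move=> p0 q0 pq.
have pm F : mean [set F' | F' \in permutations F] (average (permutations F)).
  apply: average_mean; rewrite -has_predT; apply/hasP; exists F => //.
  by rewrite mem_permutations.
apply: (mean_bind (n := fun F Phi => symmetrize Phi F) (rsub_mean Y p0 q0 pq)).
  by move=> F; exact: mean_sub (@subsetT _ _) (pm F).
move=> F FY; apply: mean_sub (pm F) => F'; rewrite /= mem_permutations => FF' x xY qx.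
by rewrite (perm_mem FF'); exact: FY.
Qed.

(* Cauchy-Schwarz for [a^2 - b^2 = (a - b) (a + b)], propagated along [Y]
   through the amplitudes [A] and [C] of the entries already treated. *)
Lemma rsub_hellinger (a1 a0 b1 b0 : X -> R) (e A C : R) Y Phi : 0 < e ->
  (forall F, `|Phi F| <= 1) ->
  let one := fun _ : seq X => 1 in
  let P := rsub (fun x => a1 x ^+ 2) (fun x => a0 x ^+ 2) Y in
  let Q := rsub (fun x => b1 x ^+ 2) (fun x => b0 x ^+ 2) Y in
  let M := rsub (fun x => a1 x * b1 x) (fun x => a0 x * b0 x) Y in
  A ^+ 2 * P Phi - C ^+ 2 * Q Phi <=
    e / 2 * (A ^+ 2 * P one + 2 * (A * C) * M one + C ^+ 2 * Q one) +
    (2 * e)^-1 * (A ^+ 2 * P one - 2 * (A * C) * M one + C ^+ 2 * Q one).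
Proof.
move=> e0; elim: Y A C Phi => [|x Y IH] A C Phi Phi1 /=.
  have := Phi1 [::]; rewrite ler_norml => /andP[u1 u2]; move: (Phi [::]) u1 u2 => f f1 f2.
  rewrite -subr_ge0.
  (* The weighted AM-GM inequality, written as a completed square. *)
  rewrite (_ : _ - _ = (2 * e)^-1 * ((e * (A + C) - f * (A - C)) ^+ 2 +
    (1 - f ^+ 2) * (A - C) ^+ 2)).
    apply: mulr_ge0; first by rewrite invr_ge0 mulr_ge0 // ltW.
    apply: addr_ge0; first exact: sqr_ge0.
    by apply: mulr_ge0; [nra|exact: sqr_ge0].
  by field; rewrite gt_eqF.
have I1 := IH (A * a1 x) (C * b1 x) (fun F => Phi (x :: F)) (fun F => Phi1 _).
have I0 := IH (A * a0 x) (C * b0 x) Phi Phi1.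
apply: le_trans (le_trans (lerD I1 I0) _).
  by rewrite le_eqVlt; apply/orP; left; apply/eqP; ring.
by rewrite le_eqVlt; apply/orP; left; apply/eqP; field; rewrite gt_eqF.
Qed.

End RandomSubsequence.

(** * Hellinger estimates for independent random subsets *)

Section Amplitudes.
Local Open Scope classical_set_scope.
Local Open Scope ring_scope.
Variables (R : realType) (X : eqType).
Implicit Types (t : X -> R) (Y F : seq X) (Phi : seq X -> R).

(* The rational parametrization of the quarter circle; it is smooth at both
   ends, unlike [(sqrt t, sqrt (1 - t))]. *)
Definition amp1 (t : R) := 2 * t / (1 + t ^+ 2).
Definition amp0 (t : R) := (1 - t ^+ 2) / (1 + t ^+ 2).

Lemma amp_den_gt0 (t : R) : 0 < 1 + t ^+ 2.
Proof. by rewrite ltr_wpDr // sqr_ge0. Qed.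

Lemma amp_sum (t : R) : amp1 t ^+ 2 + amp0 t ^+ 2 = 1.
Proof. by rewrite /amp1 /amp0; field; rewrite gt_eqF // amp_den_gt0. Qed.

Lemma amp_ge0 (t : R) : 0 <= t <= 1 -> 0 <= amp1 t /\ 0 <= amp0 t.
Proof.
move=> /andP[t0 t1]; split; apply: divr_ge0; rewrite ?(ltW (amp_den_gt0 t)) //.
  by rewrite mulr_ge0.
by rewrite subr_ge0 expr_le1.
Qed.

Lemma amp_dot_le1 (s t : R) : amp1 s * amp1 t + amp0 s * amp0 t <= 1.
Proof.
rewrite -subr_ge0 (_ : _ - _ = 2^-1 * ((amp1 s - amp1 t) ^+ 2 +
  (amp0 s - amp0 t) ^+ 2 + (1 - (amp1 s ^+ 2 + amp0 s ^+ 2)) +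
  (1 - (amp1 t ^+ 2 + amp0 t ^+ 2)))); last by field.
by rewrite !amp_sum; have := sqr_ge0 (amp1 s - amp1 t); have := sqr_ge0 (amp0 s - amp0 t); lra.
Qed.

(** The inner product of the two points of the circle is exactly
    [1 - 2 (s - t)^2 / ((1 + s^2) (1 + t^2))]. *)
Lemma amp_dot_ge (s t : R) :
  1 - 2 * (s - t) ^+ 2 <= amp1 s * amp1 t + amp0 s * amp0 t.
Proof.
have s0 := amp_den_gt0 s; have t0 := amp_den_gt0 t.
rewrite (_ : amp1 s * _ + _ = 1 - 2 * ((s - t) ^+ 2 / ((1 + s ^+ 2) * (1 + t ^+ 2)))).
  rewrite lerB // ler_pM2l // ler_pdivrMr ?mulr_gt0 // ler_peMr ?sqr_ge0 //.
  by have := sqr_ge0 s; have := sqr_ge0 t; nra.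
by rewrite /amp1 /amp0; field; rewrite !gt_eqF.
Qed.

Definition rindep t Y Phi : R :=
  rsub (fun x => amp1 (t x) ^+ 2) (fun x => amp0 (t x) ^+ 2) Y Phi.

(** The total weight is the product of the [p x + q x], so the lower bound is the union bound for
    such a product. *)
Lemma rsub_one_bounds (p q : X -> R) Y : (forall x, 0 <= p x) ->
  (forall x, 0 <= q x) -> (forall x, p x + q x <= 1) ->
  0 <= rsub p q Y (fun=> 1) <= 1 /\
  1 - \sum_(x <- Y) (1 - (p x + q x)) <= rsub p q Y (fun=> 1).
Proof.
move=> p0 q0 pq; elim: Y => [|x Y [IH1 IH2]] /=.
  by rewrite big_nil subr0 ler01 !lexx.
rewrite big_cons -mulrDl; move: IH1 IH2; set r := rsub _ _ _ _.
set s := \sum_(_ <- _) _ => /andP[r0 r1] rs.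
by have := p0 x; have := q0 x; have := pq x; split; nra.
Qed.

Lemma rindep_mean t Y :
  mean [set F : seq X | forall x, x \in Y -> t x = 1 -> x \in F]
    (fun Phi => rindep t Y (symmetrize Phi)).
Proof.
apply: mean_sub (rsub_sym_mean (p := fun x => amp1 (t x) ^+ 2)
  (q := fun x => amp0 (t x) ^+ 2) Y _ _ _).
- by move=> F FY x xY tx; apply: FY => //; rewrite tx /amp0 expr1n subrr mul0r expr0n.
- by move=> x; exact: sqr_ge0.
- by move=> x; exact: sqr_ge0.
- by move=> x; exact: amp_sum.
Qed.

(** [rsub_hellinger] with unit amplitudes: both total weights are 1, and the mixed weight [r], the
    Hellinger affinity, satisfies [r <= 1] and [1 - r <= 2 * E] for the sum of squares [E]. *)
Lemma rindep_close t t' Y Phi (e : R) : (forall x, 0 <= t x <= 1) ->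
  (forall x, 0 <= t' x <= 1) -> 0 < e -> (forall F, `|Phi F| <= 1) ->
  `|rindep t Y Phi - rindep t' Y Phi| <=
  2 * e + 2 / e * \sum_(x <- Y) (t x - t' x) ^+ 2.
Proof.
wlog suff W : t t' / (forall x, 0 <= t x <= 1) -> (forall x, 0 <= t' x <= 1) ->
    0 < e -> (forall F, `|Phi F| <= 1) ->
    rindep t Y Phi - rindep t' Y Phi <=
    2 * e + 2 / e * \sum_(x <- Y) (t x - t' x) ^+ 2.
  move=> t01 t'01 e0 Phi1; rewrite ler_norml W // andbT lerNl opprB.
  apply: le_trans (W t' t t'01 t01 e0 Phi1) _.
  by under eq_bigr => x _ do rewrite -sqrrN opprB.
move=> t01 t'01 e0 Phi1.
have := rsub_hellinger (fun x => amp1 (t x)) (fun x => amp0 (t x))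
  (fun x => amp1 (t' x)) (fun x => amp0 (t' x)) 1 1 Y e0 Phi1.
rewrite /= !expr1n !mul1r !mulr1.
have one1 (u : X -> R) :
    rsub (fun x => amp1 (u x) ^+ 2) (fun x => amp0 (u x) ^+ 2) Y (fun=> 1) = 1.
  by apply: (mean1 (rsub_mean Y _ _ _)) => x; rewrite ?sqr_ge0 ?amp_sum.
rewrite !one1 => /le_trans; apply.
have p0 x : 0 <= amp1 (t x) * amp1 (t' x).
  by apply: mulr_ge0; [case: (amp_ge0 (t01 x))|case: (amp_ge0 (t'01 x))].
have q0 x : 0 <= amp0 (t x) * amp0 (t' x).
  by apply: mulr_ge0; [case: (amp_ge0 (t01 x))|case: (amp_ge0 (t'01 x))].
have [] := rsub_one_bounds Y p0 q0 (fun x => amp_dot_le1 (t x) (t' x)).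
set r := rsub _ _ _ _ => /andP[r0 r1] rs.
have {}rs : 1 - r <= 2 * \sum_(x <- Y) (t x - t' x) ^+ 2.
  rewrite lerBlDr -lerBlDl; apply: le_trans rs; rewrite lerB //.
  by rewrite mulr_sumr; apply: ler_sum => x _; have := amp_dot_ge (t x) (t' x); lra.
move: rs; set E := \sum_(_ <- _) _ => rs.
apply: lerD.
  have -> : 2 * e = e / 2 * 4 by field.
  by apply: ler_wpM2l; [rewrite divr_ge0 // ltW|lra].
have -> : 2 / e * E = (2 * e)^-1 * (4 * E) by field; rewrite gt_eqF.
by apply: ler_wpM2l; [rewrite invr_ge0 mulr_ge0 // ltW|lra].
Qed.

(** Entries with [t = 0] are dropped with certainty, and symmetry makes the order of the list
    irrelevant. *)
Lemma rindep_super t Y Y' Phi : symmetric_fun Phi -> uniq Y -> uniq Y' ->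
  {subset Y <= Y'} -> (forall x, x \notin Y -> t x = 0) ->
  rindep t Y Phi = rindep t Y' Phi.
Proof.
move=> Phis uY uY' YY' t0.
rewrite /rindep -(@rsub_filter _ _ _ _ (fun x => x \in Y) Y').
- apply: rsub_perm => //; apply: uniq_perm => //; first exact: filter_uniq.
  by move=> x; rewrite mem_filter andb_idr //; exact: YY'.
- by move=> x /t0 ->; rewrite /amp1 mulr0 mul0r expr0n.
- by move=> x /t0 ->; rewrite /amp0 expr0n /= subr0 addr0 divr1 expr1n.
Qed.

(** Mapping the random subset by [h] replaces [t] by its composition with the inverse [k] and [Y] by
    its image; both laws are then compared on one list containing both supports. *)
Lemma rindep_translate t Y (h k : X -> X) Phi (e : R) :
  (forall x, 0 <= t x <= 1) -> uniq Y -> (forall x, x \notin Y -> t x = 0) ->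
  cancel h k -> cancel k h -> 0 < e -> (forall F, `|Phi F| <= 1) ->
  `|rindep t Y (symmetrize (fun F => Phi (map h F))) -
    rindep t Y (symmetrize Phi)| <=
  2 * e + 2 / e * \sum_(x <- undup (Y ++ map h Y)) (t (k x) - t x) ^+ 2.
Proof.
move=> t01 uY t0 hK kK e0 Phi1; set Y' := undup _.
have uY' : uniq Y' by exact: undup_uniq.
rewrite (rindep_super (Y' := Y') (symmetrize_sym Phi) uY) //; last first.
  by move=> x xY; rewrite mem_undup mem_cat xY.
rewrite (_ : rindep t Y _ = rindep (fun x => t (k x)) Y' (symmetrize Phi)).
  apply: rindep_close => // F; have PF : (0 < size (permutations F))%N.
    by rewrite -has_predT; apply/hasP; exists F => //; rewrite mem_permutations.
  exact: (mean_norm (mean_sub (@subsetT _ _) (average_mean R PF))).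
rewrite -(rindep_super (Y := map h Y) (Y' := Y')) //.
- rewrite /rindep -(rsub_map (fun x => amp1 (t x) ^+ 2) (fun x => amp0 (t x) ^+ 2) Y _ hK).
  apply: eq_rsub => F.
  exact: symmetrize_map.
- exact: symmetrize_sym.
- by rewrite map_inj_uniq //; exact: can_inj hK.
- by move=> x xY; rewrite mem_undup mem_cat xY orbT.
- move=> x xY; apply: t0; apply: contra xY => kxY.
  by rewrite -(kK x); exact: map_f.
Qed.

End Amplitudes.

(** * Dirichlet energy of the logarithmic potential *)

Section Energy.
Local Open Scope ring_scope.

(** Each summand is at most [Q (i + K) - Q i], and the sum of these differences telescopes to at
    most [K] terms. *)
Lemma sum_crossing (P Q : nat -> bool) (K m n : nat) :
  (forall i, P i -> Q (i + K)%N) -> (forall i, Q i -> Q i.+1) ->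
  (\sum_(m <= i < n) (P i && ~~ Q i) <= K)%N.
Proof.
move=> PQ QS; have [nm|mn] := leqP n m; first by rewrite big_geq.
have Qm i j : Q i -> Q (i + j)%N by elim: j => [|j IH] Qi; rewrite ?addn0 // addnS QS ?IH.
rewrite -(leq_add2r (\sum_(m <= i < n) Q i)%N).
apply: (@leq_trans (\sum_(m <= i < n) Q (i + K))%N).
  rewrite -big_split /=; apply: leq_sum => i _.
  case Qi: (Q i); first by rewrite (Qm _ K Qi) andbF.
  by case Pi: (P i) => //; rewrite (PQ _ Pi).
have -> : (\sum_(m <= i < n) Q (i + K) = \sum_(m + K <= i < n + K) Q i)%N.
  by rewrite big_addn addnK.
apply: (@leq_trans (\sum_(m <= i < n + K) Q i)%N).
  by rewrite [leqRHS](big_cat_nat (n := m + K)) /= ?leq_addr ?leq_addl // leq_add2r ltnW.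
rewrite (big_cat_nat (n := n)) /= ?leq_addr ?(ltnW mn) // addnC leq_add2r.
apply: (@leq_trans (\sum_(n <= i < n + K) 1)%N); first by apply: leq_sum => i _; case: (Q i).
by rewrite sum_nat_const_nat muln1 addKn.
Qed.

Lemma sum_sqr_le (R : realType) (I : Type) (r : seq I) (f w g : I -> R) :
  (forall i, 0 <= w i) -> (forall i, 0 <= g i) ->
  (forall i, f i ^+ 2 <= w i * g i) ->
  (\sum_(i <- r) f i) ^+ 2 <= (\sum_(i <- r) w i) * (\sum_(i <- r) g i).
Proof.
move=> w0 g0 fwg; elim: r => [|i r IH]; first by rewrite !big_nil expr0n mul0r.
rewrite !big_cons.
have := sumr_ge0 r (P := predT) (fun i _ => w0 i).
have := sumr_ge0 r (P := predT) (fun i _ => g0 i).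
move: IH (fwg i) (w0 i) (g0 i).
move: (f i) (w i) (g i) (\sum_(_ <- _) f _) (\sum_(_ <- _) w _) (\sum_(_ <- _) g _).
move=> a b c A D C ADC abc b0 c0 C0 D0.
(* Induction step of Cauchy-Schwarz: the cross term is bounded by AM-GM from the product of the two
   square bounds. *)
suff : 2 * a * A <= b * C + D * c by nra.
have [|aA] := lerP (2 * a * A) 0; first by move=> /le_trans; apply; nra.
rewrite -(@ler_pXn2r _ 2) ?nnegrE ?(ltW aA) //; last by nra.
have : a ^+ 2 * A ^+ 2 <= (b * c) * (D * C) by apply: ler_pM; rewrite ?sqr_ge0.
have := sqr_ge0 (b * C - D * c); nra.
Qed.

Variables (R : realType) (X : eqType) (C : nat -> pred X) (k : X -> X) (K c : nat).
Hypothesis CS : forall n x, C n x -> C n.+1 x.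
Hypothesis Ck : forall n x, C n x -> C (n + K)%N (k x).
Hypothesis kC : forall n x, C n (k x) -> C (n + K)%N x.
Hypothesis Cc : forall n Y, uniq Y ->
  (count (fun x => C n x != C n (k x)) Y <= c * n.+1)%N.

Definition harm m n : R := \sum_(m <= i < n) i.+1%:R^-1.

Definition potential m n x : R :=
  (harm m n)^-1 * \sum_(m <= i < n) i.+1%:R^-1 * (C i x)%:R.

Lemma harm_ge0 m n : 0 <= harm m n.
Proof. by apply: sumr_ge0 => i _; rewrite invr_ge0. Qed.

Lemma potential_01 m n x : 0 <= potential m n x <= 1.
Proof.
have H0 := harm_ge0 m n; apply/andP; split.
  by rewrite mulr_ge0 ?invr_ge0 //; apply: sumr_ge0 => i _; rewrite mulr_ge0 ?invr_ge0.
have [H1|H1] := eqVneq (harm m n) 0; first by rewrite /potential H1 invr0 mul0r.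
rewrite /potential mulrC ler_pdivrMr ?mul1r ?lt_def ?H1 //.
by apply: ler_sum => i _; rewrite ler_piMr ?invr_ge0 // lern1 leq_b1.
Qed.

Lemma C_le m n x : (m <= n)%N -> C m x -> C n x.
Proof. by move=> /subnK <-; elim: (n - m)%N => // i IH /IH /CS. Qed.

Lemma potential_1 m n x : 0 < harm m n -> C m x -> potential m n x = 1.
Proof.
move=> H0 Cx; rewrite /potential (_ : \sum_(_ <= _ < _) _ = harm m n).
  by rewrite mulVf // gt_eqF.
by apply: eq_big_nat => i /andP[mi _]; rewrite (C_le mi Cx) mulr1.
Qed.

Lemma potential_0 m n x : ~~ C n x -> potential m n x = 0.
Proof.
move=> Cx; rewrite /potential big_nat big1 ?mulr0 // => i /andP[_ ilt].
rewrite (_ : C i x = false) ?mulr0 //; apply: contraNF Cx.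
by apply: C_le; exact: ltnW.
Qed.

(** For a given [x], membership in [C i] changes under [k] for at most [2 * K] indices, so
    Cauchy-Schwarz bounds the squared difference by the weights [(i + 1)^-2] at those indices.
    Summing over [x] first costs [c * (i + 1)] at index [i], and the harmonic sum that remains
    cancels one of the two normalizing factors. *)
Lemma potential_energy m n Y : 0 < harm m n -> uniq Y ->
  \sum_(x <- Y) (potential m n (k x) - potential m n x) ^+ 2 <=
  (2 * K * c)%N%:R / harm m n.
Proof.
move=> H0 uY; pose w i x : R := (C i x != C i (k x))%:R.
have w01 i x : w i x ^+ 2 = w i x by rewrite /w; case: (_ != _); rewrite ?expr1n ?expr0n.
have pointwise x : (potential m n (k x) - potential m n x) ^+ 2 <=
    (harm m n)^-2 * ((2 * K)%N%:R * \sum_(m <= i < n) i.+1%:R^-2 * w i x).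
  rewrite /potential -mulrBr exprMn exprVn ler_wpM2l ?invr_ge0 ?sqr_ge0 //.
  rewrite -sumrB.
  apply: le_trans (sum_sqr_le (w := fun i => w i x)
    (g := fun i => i.+1%:R^-2 * w i x) _ _ _ _) _.
  - by move=> i; exact: ler0n.
  - by move=> i; rewrite mulr_ge0 ?invr_ge0 ?exprn_ge0 // ler0n.
  - move=> i; rewrite -mulrBr exprMn exprVn [leRHS]mulrCA.
    apply: ler_wpM2l; first by rewrite invr_ge0 exprn_ge0.
    rewrite -expr2 w01 /w.
    by case: (C i x) (C i (k x)) => -[]; rewrite ?subrr ?subr0 ?sub0r ?sqrrN ?expr1n ?expr0n.
  rewrite ler_wpM2r //.
    by apply: sumr_ge0 => i _; rewrite mulr_ge0 ?invr_ge0 ?exprn_ge0 // ler0n.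
  rewrite /w -natr_sum ler_nat mul2n -addnn.
  apply: (@leq_trans (\sum_(m <= i < n) (C i x && ~~ C i (k x)) +
      \sum_(m <= i < n) (C i (k x) && ~~ C i x))%N).
    by rewrite -big_split; apply: leq_sum => i _; case: (C i x) (C i (k x)) => -[].
  by apply: leq_add; apply: sum_crossing => i;
    [exact: Ck|exact: CS|exact: kC|exact: CS].
apply: (@le_trans _ _ (\sum_(x <- Y) (harm m n)^-2 *
    ((2 * K)%N%:R * \sum_(m <= i < n) i.+1%:R^-2 * w i x))).
  by apply: ler_sum => x _; exact: pointwise.
rewrite -!mulr_sumr exchange_big /=.
have -> : (2 * K * c)%N%:R / harm m n =
    (harm m n)^-2 * ((2 * K)%N%:R * (c%:R * harm m n)).
  by rewrite natrM; field; rewrite gt_eqF.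
rewrite ler_wpM2l ?invr_ge0 ?sqr_ge0 // ler_wpM2l ?ler0n // /harm mulr_sumr.
apply: ler_sum => i _; rewrite -mulr_sumr /w -natr_sum.
have -> : c%:R * i.+1%:R^-1 = i.+1%:R^-2 * (c * i.+1)%N%:R :> R.
  have : i.+1%:R != 0 :> R by rewrite pnatr_eq0.
  by rewrite natrM; move: (i.+1%:R : R) => a a0; field.
rewrite ler_wpM2l ?invr_ge0 ?exprn_ge0 // ler_nat.
apply: leq_trans (Cc i uY); rewrite -sum1_count [leqRHS]big_mkcond /=.
by apply: leq_sum => x _; case: (_ != _).
Qed.

End Energy.

Lemma harm_unbounded (R : realType) (m : nat) (M : R) :
  exists n, (M <= harm R m n)%R.
Proof.
have nd : nondecreasing_seq (series (@harmonic R)).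
  apply/nondecreasing_seqP => n; rewrite seriesSr lerDl.
  exact: harmonic_ge0.
have /cvgryPge /(_ (M + series (@harmonic R) m)%R) [n _ nP] :=
  nondecreasing_dvgn_lt nd (@dvg_harmonic R).
exists (maxn m n); have /= := nP (maxn m n) (leq_maxr _ _).
by rewrite -lerBrDr sub_series_geq ?leq_maxl.
Qed.

(** * Recurrence on rays *)

Section Recurrence.
Local Open Scope classical_set_scope.
Local Open Scope ring_scope.
Variables (G : groupType) (B : finType) (S : self_similar G B).
Implicit Types (g h : G) (x : B) (xi : nat -> B) (N : set G).
Local Notation sec := (ss_sec S).
Local Notation ray_section := (ray_section S).
Local Notation rayact := (ray_act S).

Fixpoint nb_active g n : nat :=
  if n is k.+1 then (\sum_(x : B) nb_active (sec g x) k)%N else g != 1%g.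

Fixpoint tails n : seq (nat -> B) :=
  if n is k.+1 then flatten [seq map (ray_cons x) (tails k) | x <- enum B]
  else [seq (fun=> x) | x <- enum B].

Lemma mem_tails n xi : const_from n xi -> xi \in tails n.
Proof.
elim: n xi => [|n IH] xi xiC /=.
  apply/mapP; exists (xi 0%N); first by rewrite mem_enum.
  by apply/funext => k; exact: xiC.
apply/flatten_mapP; exists (xi 0%N); first by rewrite mem_enum.
apply/mapP; exists (ray_shift xi); last by rewrite ray_cons_shift.
by apply: IH; exact: tailc_ray_shift.
Qed.

(* The rays constant from [n] whose section at level [n] is not trivial; all rays
   constant from [n] that [g] maps outside that class are among them. *)
Fixpoint exits g n : seq (nat -> B) :=
  if n is k.+1 then
    flatten [seq map (ray_cons x) (exits (sec g x) k) | x <- enum B]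
  else if g == 1%g then [::] else [seq (fun=> x) | x <- enum B].

Lemma size_exits g n : size (exits g n) = (#|B| * nb_active g n)%N.
Proof.
elim: n g => [|n IH] g /=.
  by case: (g == 1%g); rewrite /= ?muln0 // size_map -cardE muln1.
rewrite size_flatten /shape -map_comp sumnE big_map big_enum /= big_distrr /=.
by apply: eq_bigr => x _; rewrite /= size_map IH.
Qed.

Lemma mem_exits g n xi : const_from n xi -> ray_section g xi n != 1%g -> xi \in exits g n.
Proof.
elim: n g xi => [|n IH] g xi xiC.
  move=> /= /negbTE ->; apply/mapP; exists (xi 0%N); first by rewrite mem_enum.
  by apply/funext => k; exact: xiC.
rewrite secpS => g1; apply/flatten_mapP; exists (xi 0%N); first by rewrite mem_enum.
apply/mapP; exists (ray_shift xi); last by rewrite ray_cons_shift.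
by apply: IH => //; exact: tailc_ray_shift.
Qed.

Lemma exits_rayact g n xi : const_from n xi -> ~ const_from n (rayact g xi) ->
  xi \in exits g n.
Proof.
move=> xiC nC; apply: mem_exits => //; apply/eqP => g1; apply: nC.
have gE k : (n <= k)%N -> rayact g xi k = xi k.
  by move=> /subnKC <-; rewrite /ray_act secpD g1 secp1 ss_act1.
by move=> k nk; rewrite !gE // xiC.
Qed.

Definition ctail n : pred (nat -> B) := fun xi => `[< const_from n xi >].

(** A ray leaving the class under [g] is an exit of [g]; a ray entering it is the preimage of an
    exit of the inverse of [g]. *)
Lemma ctail_crossings g n (Y : seq (nat -> B)) : uniq Y ->
  (count (fun xi => ctail n xi != ctail n (rayact g xi)) Y <=
   #|B| * nb_active g n + #|B| * nb_active g^-1 n)%N.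
Proof.
move=> uY; rewrite -!size_exits -size_filter.
rewrite -[X in (_ + X)%N](size_map (rayact g^-1)) -size_cat.
apply: uniq_leq_size; first exact: filter_uniq.
move=> xi; rewrite mem_filter mem_cat => /andP[+ _].
have [xiC|nxiC] := boolP (ctail n xi);
  have [gC|ngC] := boolP (ctail n (rayact g xi)) => // _.
  by apply/orP; left; apply: exits_rayact; [exact: asboolW|exact/asboolPn].
apply/orP; right; rewrite -[xi](rayactK S g); apply/map_f/exits_rayact.
  exact: asboolW.
by rewrite rayactK; exact/asboolPn.
Qed.

Lemma rayact_tailc g K n xi : stabilizes S K g -> const_from n xi ->
  const_from (n + K) (rayact g xi).
Proof.
move=> gK xiC k nk.
have sE i : (n + K <= i)%N -> ray_section g xi i = ray_section g xi (n + K).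
  move=> /subnK <-; elim: (i - (n + K))%N => // j IH.
  by rewrite addSn (gK n) // leq_addl.
rewrite /ray_act sE // xiC ?(xiC (n + K)%N) ?leq_addr //.
exact: leq_trans (leq_addr _ _) nk.
Qed.

Variables (N : set G) (gN : section_group S N) (R : realType).
Local Notation E := (ext S N).
Hypothesis linear : forall g, E g -> exists c, forall n, (nb_active g n <= c * n.+1)%N.

Let EV g : E g -> E g^-1%g.
Proof. by case: (good_sgp (ext_good gN)) => _ _; apply. Qed.

Lemma ray_energy g : E g -> exists D : nat,
  forall m n (Y : seq (nat -> B)), 0 < harm R m n -> uniq Y ->
  \sum_(xi <- Y) (potential R ctail m n (rayact g xi) -
    potential R ctail m n xi) ^+ 2 <= D%:R / harm R m n.
Proof.
move=> Eg; have [K1 gK] := ext_uec gN Eg; have [K2 hK] := ext_uec gN (EV Eg).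
have [c1 c1P] := linear Eg; have [c2 c2P] := linear (EV Eg).
pose K := maxn K1 K2.
exists (2 * K * (#|B| * c1 + #|B| * c2))%N => m n Y H0 uY.
apply: potential_energy => //.
- move=> i xi /asboolP xiC; apply/asboolP; exact: tailc_le xiC.
- move=> i xi /asboolP xiC; apply/asboolP; apply: rayact_tailc => //.
  by apply: uec_le gK; exact: leq_maxl.
- move=> i xi /asboolP xiC; apply/asboolP; rewrite -(rayactK S g xi).
  by apply: rayact_tailc => //; apply: uec_le hK; exact: leq_maxr.
- move=> i Y' uY'; apply: leq_trans (ctail_crossings g i uY') _.
  by rewrite mulnDl -!mulnA leq_add // leq_mul2l ?c1P ?c2P orbT.
Qed.

(** The random subset of rays defined by the potential contains every ray constant from [m], where
    the potential is 1, and it is nearly invariant because the energy tends to 0 as [n] grows. *)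
Lemma approx_mean (s : seq G) (m : nat) (d : R) : 0 < d ->
  exists M, mean [set F : seq (nat -> B) | forall xi, const_from m xi -> xi \in F] M /\
    forall g u (C : R), g \in s -> E g -> 0 < C -> (forall F, `|u F| <= C) ->
    `|M (fun F => u (map (rayact g) F)) - M u| <= C * d.
Proof.
move=> d0.
(* The inverse appears because [rindep_translate] composes the potential with the inverse of the
   translation. *)
have /choice [f fP] g : exists D : nat, E g ->
    forall m n (Y : seq (nat -> B)), 0 < harm R m n -> uniq Y ->
    \sum_(xi <- Y) (potential R ctail m n (rayact g^-1 xi) -
      potential R ctail m n xi) ^+ 2 <= D%:R / harm R m n.
  have [Eg|nEg] := pselect (E g); last by exists 0%N.
  by have [D DP] := ray_energy (EV Eg); exists D.
(* [D] bounds all the energy constants at once. With energy at most [e ^+ 2], the translation bound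
   becomes [4 * e = d]. *)
pose D := (\sum_(g <- s) f g)%N; pose e := d / 4.
have e0 : 0 < e by rewrite divr_gt0.
(* The summand 1 ensures that the harmonic sum is positive; the other one brings the energy below
   [e ^+ 2]. *)
have [n nH] := harm_unbounded m (1 + D%:R / e ^+ 2).
have H0 : 0 < harm R m n.
  by apply: lt_le_trans nH; rewrite ltr_wpDr // divr_ge0 // sqr_ge0.
pose t := potential R ctail m n; pose Y := undup (tails n).
have cS i xi : ctail i xi -> ctail i.+1 xi.
  by move=> /asboolP xiC; apply/asboolP; exact: tailc_le xiC.
have t01 xi : 0 <= t xi <= 1 by exact: potential_01.
have t0 xi : xi \notin Y -> t xi = 0.
  move=> xiY; apply: potential_0 => //; apply: contra xiY => /asboolP xiC.
  by rewrite mem_undup mem_tails.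
have t1 xi : const_from m xi -> t xi = 1.
  by move=> xiC; apply: potential_1 => //; apply/asboolP.
exists (fun u => rindep t Y (symmetrize u)); split.
  apply: mean_sub (rindep_mean t Y) => F FY xi xiC; apply: FY; last exact: t1.
  by apply: contraT => /t0; rewrite t1 // => /eqP; rewrite oner_eq0.
move=> g u C gs Eg C0 uC.
have mT : mean setT (fun u => rindep t Y (symmetrize u)).
  exact: mean_sub (@subsetT _ _) (rindep_mean t Y).
pose v F := C^-1 * u F.
have v1 F : `|v F| <= 1.
  by rewrite /v normrM normfV (gtr0_norm C0) mulrC ler_pdivrMr // mul1r.
have bv : bounded_fct v by exists 1.
have uE : u = fun F => C * v F.
  by apply/funext => F; rewrite /v mulrA divff ?mul1r // gt_eqF.
rewrite {1}uE (meanZ mT C (bnd_comp (map (rayact g)) bv)) uE (meanZ mT C bv).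
rewrite -mulrBr normrM (gtr0_norm C0) ler_wpM2l ?(ltW C0) //.
apply: le_trans (rindep_translate t01 (undup_uniq _) t0 (rayactK S g) (rayactVK S g) e0 v1) _.
have En := fP g Eg m n _ H0 (undup_uniq (Y ++ map (rayact g) Y)).
have fD : (f g)%:R / harm R m n <= e ^+ 2.
  rewrite ler_pdivrMr // mulrC -ler_pdivrMr ?exprn_gt0 //.
  apply: le_trans nH; rewrite ler_wpDl // ler_wpM2r ?invr_ge0 ?sqr_ge0 // ler_nat.
  by rewrite /D (big_rem g) //= leq_addr.
apply: (@le_trans _ _ (2 * e + 2 / e * e ^+ 2)).
  rewrite lerD2l; apply: ler_wpM2l; first by rewrite divr_ge0 // ltW.
  exact: le_trans En fD.
by rewrite le_eqVlt (_ : _ + _ = d) ?eqxx // /e; field; rewrite gt_eqF.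
Qed.

(** The limit is taken along pairs of a finite list of elements and a level, ordered by inclusion
    and size, with tolerance tending to 0 as the level grows. *)
Lemma amen_ext_linear : mean_amenable R N -> mean_amenable R E.
Proof.
move=> aN.
have /choice [M MP] (i : seq G * nat) := approx_mean i.1 i.2
  (harmonic_gt0 i.2 : 0 < i.2.+1%:R^-1 :> R).
pose F : set_system (seq G * nat) := [set A | exists i0 : seq G * nat,
  forall i : seq G * nat, {subset i0.1 <= i.1} -> (i0.2 <= i.2)%N -> A i].
have FF : ProperFilter F.
  split; first by case=> i /(_ i) /(_ (fun _ => id) (leqnn _)).
  split.
  - by exists ([::], 0%N).
  - move=> P Q [i iP] [j jQ]; exists (i.1 ++ j.1, maxn i.2 j.2) => k /= ks kn.
    split; [apply: iP|apply: jQ].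
    + by move=> g gi; apply: ks; rewrite mem_cat gi.
    + exact: leq_trans (leq_maxl _ _) kn.
    + by move=> g gi; apply: ks; rewrite mem_cat gi orbT.
    + exact: leq_trans (leq_maxr _ _) kn.
  - by move=> P Q PQ [i iP]; exists i => j ij1 ij2; apply/PQ/iP.
have MT i : mean setT (M i) := mean_sub (@subsetT _ _) (MP i).1.
have [m [mT m0 mE]] := mean_ultralimit FF MT.
apply: (amen_ext gN (m := m)) => // [n|g u Eg bu].
  apply: mean_carrier => // u bu u0; apply: m0 => //; exists ([::], n) => i _ ni.
  apply: (mean_ge0 (MP i).1) => // s si; apply: u0 => xi xin; apply: si.
  exact: tailc_le xin.
apply: mE => // [|e e0]; first exact: bnd_comp.
have [C uC] := bu; pose C' := `|C| + 1.
have C'0 : 0 < C' by rewrite ltr_wpDl.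
have uC' s : `|u s| <= C'.
  by apply: le_trans (uC s) (le_trans (ler_norm C) _); rewrite lerDl.
(* From this level on the error [C' / (i.2 + 1)] is at most [e]. *)
exists ([:: g], `|Num.ceil (C' / e)|%N) => i gi ni /=.
apply: le_trans ((MP i).2 g u C' _ Eg C'0 uC') _; first by apply: gi; rewrite mem_head.
rewrite ler_pdivrMr // mulrC -ler_pdivrMr //.
apply: le_trans (ceil_ge _) _; apply: le_trans (_ : `|Num.ceil (C' / e)|%:~R <= _).
  by rewrite ler_int ler_norm.
by rewrite -abszE -pmulrn ler_nat; exact: leqW.
Qed.

End Recurrence.

(** * Activity growth *)

Lemma repeated_value (T : eqType) (f : nat -> T) (s : seq T) n :
  (size s < n)%N -> (forall i, (i < n)%N -> f i \in s) ->
  exists i j, [/\ (i < j)%N, (j < n)%N & f i = f j].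
Proof.
move=> sn fs; pose l := [seq f i | i <- iota 0 n].
have nl i : (i < n)%N -> nth (f 0%N) l i = f i.
  by move=> ilt; rewrite (nth_map 0%N) ?size_iota // nth_iota.
have : ~~ uniq l.
  apply: contraL sn => ul; rewrite -leqNgt.
  have -> : n = size l by rewrite size_map size_iota.
  by apply: uniq_leq_size => // y /mapP[i + ->]; rewrite mem_iota; exact: fs.
move=> /(uniqPn (f 0%N)) [i [j [ij jl]]]; rewrite size_map size_iota in jl.
by rewrite !nl ?(ltn_trans ij) // => fij; exists i, j.
Qed.

Lemma leq_exp2rW m n e : (m <= n)%N -> (m ^ e <= n ^ e)%N.
Proof. by case: e => // e mn; rewrite leq_exp2r. Qed.

Section Growth.
Local Open Scope classical_set_scope.
Local Open Scope nat_scope.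
Variables (G : groupType) (B : finType) (S : self_similar G B).
Implicit Types (g h a b : G) (x y w : B) (N : set G).
Local Notation sec := (ss_sec S).
Local Notation nb_active := (nb_active S).

Lemma cnt1 n : nb_active 1%g n = 0.
Proof.
by elim: n => [|n IH] /=; rewrite ?eqxx // big1 // => x _; rewrite ss_sec1.
Qed.

Lemma cnt_sum_section g n : \sum_(0 <= k < n.+1) nb_active g k =
  (g != 1%g) + \sum_x \sum_(0 <= k < n) nb_active (sec g x) k.
Proof. by rewrite big_nat_recl //= [in RHS]exchange_big. Qed.

Lemma cnt_finitary g : finitary S g ->
  exists c, forall n, \sum_(0 <= k < n) nb_active g k <= c.
Proof.
move=> [j]; elim: j g => [|j IH] g gj.
  by exists 0 => n; rewrite gj big1 // => k _; rewrite cnt1.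
have /choice [c cP] x := IH _ (gj x).
exists (1 + \sum_x c x) => -[|n]; first by rewrite big_geq.
rewrite cnt_sum_section leq_add ?leq_b1 //; apply: leq_sum => x _; exact: cP.
Qed.

(** Unrolling the loop of a directed element bounds its activity by 1 plus partial sums of the
    activities of its other sections. Hence the hypothesis on partial sums, and the gain of at most
    one degree per extension. *)
Lemma ext_growth N e :
  (forall g, N g -> exists c, forall n, \sum_(0 <= k < n) nb_active g k <= c * n.+1 ^ e) ->
  forall g, ext S N g -> exists c, forall n, nb_active g n <= c * n.+1 ^ e.
Proof.
move=> NP g; elim=> {}g.
- move=> /NP [c cP]; exists (c * 2 ^ e) => n.
  apply: (@leq_trans (\sum_(0 <= k < n.+1) nb_active g k)).
    by rewrite big_nat_recr //= leq_addl.
  apply: leq_trans (cP _) _; rewrite -mulnA leq_mul2l -expnMn.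
  by rewrite leq_exp2rW ?orbT //; lia.
- move=> [x xE xN].
  have /choice [c cP] y : exists c, y != x ->
      forall n, \sum_(0 <= k < n) nb_active (sec g y) k <= c * n.+1 ^ e.
    have [->|/xN/NP [c cP]] := eqVneq y x; first by exists 0.
    by exists c.
  exists (1 + \sum_(y | y != x) c y) => n.
  apply: (@leq_trans (1 + \sum_(y | y != x) \sum_(0 <= k < n) nb_active (sec g y) k)).
    elim: n => [|n IH] /=; first exact: leq_trans (leq_b1 _) (leq_addr _ _).
    rewrite (bigD1 x) //= xE; apply: leq_trans (leq_add IH (leqnn _)) _.
    rewrite -addnA -big_split /= leq_add2l; apply: leq_sum => y _.
    by rewrite big_nat_recr.
  rewrite mulnDl mul1n leq_add ?expn_gt0 // big_distrl /=.
  by apply: leq_sum => y /cP.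
- move=> _ /choice [c cP]; exists (1 + \sum_x c x) => -[|n] /=.
    by rewrite exp1n muln1; exact: leq_trans (leq_b1 _) (leq_addr _ _).
  rewrite mulnDl mul1n (leq_trans _ (leq_addl _ _)) // big_distrl /=.
  apply: leq_sum => x _; apply: leq_trans (cP x n) _.
  by rewrite leq_mul2l leq_exp2rW ?orbT.
Qed.

Lemma ext_finitary_growth g : ext S (finitary S) g -> exists c, forall n, nb_active g n <= c.
Proof.
move=> /(@ext_growth _ 0) [h /cnt_finitary [c cP]|c cP].
  by exists c => n; rewrite expn0 muln1.
by exists c => n; have := cP n; rewrite expn0 muln1.
Qed.

Lemma ext2_finitary_growth g : ext S (ext S (finitary S)) g ->
  exists c, forall n, nb_active g n <= c * n.+1.
Proof.
move=> /(@ext_growth _ 1) [h /ext_finitary_growth [c cP]|c cP].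
  exists c => n; rewrite expn1; apply: (@leq_trans (\sum_(0 <= k < n) c)).
    exact: leq_sum.
  by rewrite sum_nat_const_nat subn0 mulnC leq_mul2l leqnSn orbT.
by exists c => n; have := cP n; rewrite expn1.
Qed.

Lemma amen_linear (R : realType) : mean_amenable R (ext S (ext S (finitary S))).
Proof.
have gF := finitary_good S.
apply: amen_ext_linear; [exact: ext_good|exact: ext2_finitary_growth|].
apply: amen_ext_linear => //; last exact: amen_finitary.
move=> g /ext_finitary_growth [c cP]; exists c => n.
by apply: leq_trans (cP n) _; rewrite leq_pmulr.
Qed.

Lemma cnt_section g x n : nb_active (sec g x) n <= nb_active g n.+1.
Proof. by rewrite /= (bigD1 x) //= leq_addr. Qed.

(** Going around the loop [i] times and then leaving through [y] gives, for distinct [i], disjoint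
    sets of words of length [n]. *)
Lemma cnt_loop b w y n : sec b w = b -> y != w ->
  \sum_(0 <= k < n) nb_active (sec b y) k <= nb_active b n.
Proof.
move=> bw yw; elim: n => [|n IH]; first by rewrite big_geq.
rewrite big_nat_recr //= (bigD1 w) //= bw (bigD1 y) //=.
by rewrite leq_add // leq_addr.
Qed.

Lemma cnt_nonfinitary g n : ~ finitary S g -> 0 < nb_active g n.
Proof.
move=> gF; rewrite lt0n; apply/eqP => g0; apply: gF; exists n.
elim: n g g0 => [|n IH] g /= g0.
  by apply/eqP; move: g0; case: (g == 1%g).
by move=> x; apply: IH; apply/eqP; move/eqP: g0; rewrite sum_nat_eq0 => /forallP /(_ x).
Qed.

Variable A : set G.
Hypothesis finA : finite_set A.
Hypothesis secA : forall a x, A a -> A (sec a x).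
Hypothesis loopA : forall b (v : seq B), A b -> v != [::] -> foldl sec b v = b ->
  exists w, sec b w = b.

(** Sections outside [ext S N] can be followed forever; finiteness of [A] forces a repetition, which
    [loopA] turns into a loop at a single letter. The element there is not directed over [N], so a
    second letter has a section outside [N], and [cnt_loop] compares activities. *)
Lemma escape N a : A a -> ~ ext S N a ->
  exists j c, [/\ A c, ~ N c &
    forall n, \sum_(0 <= k < n) nb_active c k <= nb_active a (j + n)].
Proof.
move=> Aa nEa.
have step b : ~ ext S N b -> exists x, ~ ext S N (sec b x).
  by move=> nEb; apply: contrapT => /forallNP nx; apply: nEb;
    apply: ext_sec => x; apply: contrapT; exact: nx.
have [x0 _] := step a nEa.
have /choice [f fP] b : exists x, ~ ext S N b -> ~ ext S N (sec b x).
  have [Eb|/step [x xP]] := pselect (ext S N b); first by exists x0.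
  by exists x.
pose st i := iter i (fun b => sec b (f b)) a.
have stA i : A (st i) by elim: i => //= i; exact: secA.
have stE i : ~ ext S N (st i) by elim: i => //= i; exact: fP.
have [s sE] := (finite_seqP A).1 finA.
have [i [j [ij _ stij]]] : exists i j, [/\ i < j, j < (size s).+1 & st i = st j].
  by apply: repeated_value => // i _; have := stA i; rewrite sE.
have stD k l : st (k + l) = foldl sec (st k) [seq f (st (k + n)) | n <- iota 0 l].
  elim: l => [|l IH]; first by rewrite addn0.
  by rewrite -addn1 iotaD map_cat foldl_cat -IH /= add0n addn1 addnS.
have [||w wE] := @loopA (st i) [seq f (st (i + n)) | n <- iota 0 (j - i)] (stA i).
- by rewrite -size_eq0 size_map size_iota subn_eq0 -ltnNge.
- by rewrite -stD subnKC // ltnW.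
have [y yw nNy] : exists2 y, y != w & ~ N (sec (st i) y).
  apply: contrapT => H; apply: (stE i); apply: ext_dir; exists w => // y yw.
  by apply: contrapT => nNy; apply: H; exists y.
exists i, (sec (st i) y); split=> //; first exact: secA.
move=> n; apply: leq_trans (cnt_loop n wE yw) _.
elim: {ij stij wE nNy} i n => // i IH n; rewrite addSnnS.
by apply: leq_trans (IH n.+1); rewrite /st iterS -/(st i); exact: cnt_section.
Qed.

(** Escaping twice reaches a non-finitary element, of activity at least 1 at every level. Each of
    the two loops sums activities, so [a] would grow at least quadratically. *)
Lemma linear_activity_ext a : A a ->
  (exists C, forall n, nb_active a n <= C * n.+1) -> ext S (ext S (finitary S)) a.
Proof.
move=> Aa [C aC]; apply: contrapT => /(escape Aa) [j [b [Ab nEb ba]]].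
have [i [c [Ac nFc cb]]] := escape Ab nEb.
have bn n : n <= nb_active b (i + n).
  apply: leq_trans (cb n); apply: (@leq_trans (\sum_(0 <= k < n) 1)).
    by rewrite sum_nat_const_nat subn0 muln1.
  by apply: leq_sum => k _; exact: cnt_nonfinitary.
have quadratic n : \sum_(0 <= k < n) k <= C * (j + i + n).+1.
  apply: (@leq_trans (nb_active a (j + (i + n)))); last by rewrite -addnA; exact: aC.
  apply: leq_trans (ba (i + n)); rewrite [leqRHS](big_cat_nat (n := i)) ?leq_addr //=.
  apply: leq_trans (leq_addl _ _).
  have -> : \sum_(i <= k < i + n) nb_active b k = \sum_(0 <= k < n) nb_active b (k + i).
    by rewrite -[X in index_iota X]add0n big_addn addKn.
  by apply: leq_sum => k _; rewrite addnC.
have sumE n : (\sum_(0 <= k < n) k).*2 = n * n.-1.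
  elim: n => [|n IH]; first by rewrite big_geq.
  by rewrite big_nat_recr //= doubleD IH; case: (n) => //= n'; nia.
(* Chosen so that [n * (n - 1)] exceeds [2 * C * (j + i + n + 1)]. *)
pose n := 2 * C + 2 + 2 * C * (j + i).+1.
have := quadratic n; rewrite -leq_double sumE.
by rewrite /n; nia.
Qed.

End Growth.

(** * Tree automorphisms over blocks of letters *)

Section TreeSections.
Local Open Scope classical_set_scope.
Local Open Scope group_scope.
Variable m : nat.
Implicit Types (g h : treeaut m) (u v w : seq 'I_m).
Local Notation tsec := (@treeaut_section m).

Lemma treeaut_section_nil g : tsec g [::] = g.
Proof. by apply/esym/treeaut_section_unique => w; rewrite /= treeaut_root. Qed.

Lemma treeaut_section_mul g h v : tsec (g * h) v = tsec g v * tsec h (g v).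
Proof.
apply/esym/treeaut_section_unique => w.
by rewrite -!/(mulg _ _) /= -treeaut_sectionE -treeaut_sectionE.
Qed.

Lemma treeaut_section_cat g u v : tsec g (u ++ v) = tsec (tsec g u) v.
Proof.
apply/esym/treeaut_section_unique => w.
by rewrite -catA !treeaut_sectionE catA.
Qed.

Variable L : nat.
Hypothesis L0 : (0 < L)%N.

Definition tree_act g (w : L.-tuple 'I_m) : L.-tuple 'I_m :=
  Tuple (introT eqP (etrans (size_treeaut g w) (size_tuple w))).

Definition tree_sec g (w : L.-tuple 'I_m) := tsec g w.

Lemma tree_act1 x : tree_act 1 x = x.
Proof. exact: val_inj. Qed.

Lemma tree_actM g h x : tree_act (g * h) x = tree_act h (tree_act g x).
Proof. exact: val_inj. Qed.

Lemma tree_secM g h x :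
  tree_sec (g * h) x = tree_sec g x * tree_sec h (tree_act g x).
Proof. exact: treeaut_section_mul. Qed.

Lemma tree_faithful (P : set (treeaut m)) :
  (forall g, P g -> forall x, tree_act g x = x /\ P (tree_sec g x)) ->
  forall g, P g -> g = 1.
Proof.
move=> PP g Pg; apply: treeautP => v /=.
have [n vn] := ubnP (size v); elim: n g Pg v vn => // n IH g Pg v vn.
have [vL|Lv] := ltnP (size v) L.
  case: v vL {vn} => [|i v] vL; first by rewrite treeaut_root.
  (* A word shorter than a block is padded to a full block, which [g] fixes. *)
  pose w := (i :: v) ++ nseq (L - size (i :: v)) i.
  have wL : size w == L by rewrite size_cat size_nseq subnKC // ltnW.
  have [/(congr1 val) /= wE _] := PP g Pg (Tuple wL).
  have [u uE] := treeaut_prefix g (i :: v) (nseq (L - size (i :: v)) i).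
  move: wE; rewrite /w uE => /eqP; rewrite eqseq_cat ?size_treeaut //.
  by case/andP => /eqP.
have tL : size (take L v) == L by rewrite size_takel.
have [/(congr1 val) /= wE Ps] := PP g Pg (Tuple tL).
rewrite -{1}(cat_take_drop L v) treeaut_sectionE wE (IH _ Ps) ?cat_take_drop //.
by rewrite size_drop; lia.
Qed.

Definition portrait_fun (f : seq 'I_m -> treeaut m) v : seq 'I_m :=
  if (size v < L)%N then v else take L v ++ f (take L v) (drop L v).

Lemma portrait_funE f u v : size u = L -> portrait_fun f (u ++ v) = u ++ f u v.
Proof.
move=> uL; rewrite /portrait_fun size_cat uL ltnNge leq_addr /=.
by rewrite -uL take_size_cat // drop_size_cat.
Qed.

Lemma portrait_funK (f f' : seq 'I_m -> treeaut m) : (forall u, cancel (f u) (f' u)) ->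
  cancel (portrait_fun f) (portrait_fun f').
Proof.
move=> fK v; have [vL|Lv] := ltnP (size v) L.
  by rewrite /portrait_fun vL vL.
rewrite -{1}(cat_take_drop L v) !portrait_funE ?size_takel //.
by rewrite fK cat_take_drop.
Qed.

Lemma portrait_fun_rcons f v x :
  exists y, portrait_fun f (rcons v x) = rcons (portrait_fun f v) y.
Proof.
have [vL|Lv] := ltnP (size v) L; last first.
  rewrite -{1 2}(cat_take_drop L v) rcons_cat !portrait_funE ?size_takel //.
  have [y ->] := treeaut_rcons (f (take L v)) (drop L v) x.
  by exists y; rewrite rcons_cat.
rewrite [portrait_fun f v]/portrait_fun vL /portrait_fun size_rcons.
have [_|Lv] := ltnP; first by exists x.
have vE : size (rcons v x) = L by rewrite size_rcons; apply/eqP; rewrite eqn_leq vL.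
by exists x; rewrite -{1 3}vE take_size drop_size treeaut_root cats0.
Qed.

Lemma portrait_fun_adj (f f' : seq 'I_m -> treeaut m) : (forall u, cancel (f u) (f' u)) ->
  forall v w, Defs.adjacent (portrait_fun f v) (portrait_fun f w) <-> Defs.adjacent v w.
Proof.
move=> fK v w.
have mono F v' w' : Defs.adjacent v' w' ->
    Defs.adjacent (portrait_fun F v') (portrait_fun F w').
  case=> -[x ->].
    by have [y ->] := portrait_fun_rcons F v' x; left; exists y.
  by have [y ->] := portrait_fun_rcons F w' x; right; exists y.
split; last exact: mono.
by move=> /(mono f'); rewrite !(portrait_funK fK).
Qed.

Lemma tree_portrait (f : L.-tuple 'I_m -> treeaut m) :
  exists g, forall x, tree_act g x = x /\ tree_sec g x = f x.
Proof.
pose F (u : seq 'I_m) : treeaut m := if insub u is Some x then f x else 1.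
pose F' u := (F u)^-1.
have FK u : cancel (F u) (F' u) by exact: treeautK.
have F'K u : cancel (F' u) (F u) by exact: treeautVK.
have F0 : portrait_fun F [::] = [::] by rewrite /portrait_fun L0.
pose g := TreeAut (Bijective (portrait_funK FK) (portrait_funK F'K)) F0
  (portrait_fun_adj FK).
have gE (x : L.-tuple 'I_m) w : g (x ++ w) = x ++ f x w.
  by rewrite /= portrait_funE ?size_tuple // /F valK.
have gx (x : L.-tuple 'I_m) : g x = x.
  by have := gE x [::]; rewrite !cats0 treeaut_root cats0.
exists g => x; split; first exact/val_inj/gx.
by apply/esym/treeaut_section_unique => w; rewrite gE gx.
Qed.

Definition tree_selfsim : self_similar (treeaut m) (L.-tuple 'I_m) :=
  SelfSim tree_act1 tree_actM tree_secM tree_faithful tree_portrait.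

End TreeSections.

(** * Activity and cycles of automata *)

Section Automata.
Local Open Scope classical_set_scope.
Local Open Scope group_scope.
Variable m : nat.
Implicit Types (g h a b : treeaut m) (u v w : seq 'I_m).
Local Notation tsec := (@treeaut_section m).

Lemma activityE g n :
  activity g n = (\sum_(v : n.-tuple 'I_m) (tsec g v != 1%g))%N.
Proof.
rewrite /activity -sum1_card big_mkcond; apply: eq_bigr => v _.
by rewrite inE; case: (_ != _).
Qed.

Lemma activity0 g : activity g 0 = (g != 1) :> nat.
Proof.
rewrite activityE (bigD1 [tuple]) //= big1 => [|v].
  by rewrite treeaut_section_nil addn0.
by rewrite (tuple0 v) => /eqP.
Qed.

Lemma activityD g l n :
  activity g (l + n) = (\sum_(w : l.-tuple 'I_m) activity (tsec g w) n)%N.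
Proof.
rewrite activityE; under [RHS]eq_bigr do rewrite activityE.
rewrite pair_big /= (reindex (fun p : l.-tuple 'I_m * n.-tuple 'I_m => cat_tuple p.1 p.2)).
  by apply: eq_bigr => p _; rewrite treeaut_section_cat.
apply/onW_bij/inj_card_bij => [[v w] [v' w'] /(congr1 val) /= /eqP|]; last first.
  by rewrite card_prod !card_tuple expnD.
rewrite eqseq_cat ?size_tuple // => /andP[/eqP vv /eqP ww].
by congr pair; exact: val_inj.
Qed.

Lemma cnt_activity l (l0 : (0 < l)%N) g n :
  nb_active (tree_selfsim m l0) g n = activity g (n * l).
Proof.
elim: n g => [|n IH] g; first by rewrite activity0.
by rewrite mulSn activityD /=; apply: eq_bigr => w _; exact: IH.
Qed.

Lemma degree_le1_activity (R : realType) a : (degree R a <= 1%:Z%:E)%E ->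
  exists C, forall n, (activity a n <= C * n.+1)%N.
Proof.
(* The default [+oo] contradicts the bound, so the degree comes from an actual growth type. *)
rewrite /degree; case: xgetP => [d -> /= dP d1|_ /=]; last by rewrite leye_eq.
suff [C [n0 _ CP]] : exists C, \forall n \near \oo, (activity a n <= C * n)%N.
  exists (C + \sum_(i < n0) activity a i)%N => n; have [n0n|nn0] := leqP n0 n.
    by apply: leq_trans (CP n n0n) _; rewrite leq_mul ?leq_addr.
  rewrite mulnDl (leq_trans _ (leq_addl _ _)) // (bigD1 (Ordinal nn0)) //=.
  by rewrite mulnDl (leq_trans _ (leq_addr _ _)) // leq_pmulr.
case: dP d1 => {d} [N0 _|d c C c0 C0 [n0 _ NP]|]; last by move=> *; exfalso.
  by exists 0%N; apply: filterS N0 => n ->.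
rewrite lee_fin lez_nat => d1.
(* Starting at [n0.+1] keeps the level positive, so that its power of exponent [d <= 1] is at most
   the level itself. *)
exists `|Num.ceil C|%N; exists n0.+1 => // -[//|n] n0n.
have [_] := NP n.+1 (ltnW n0n).
rewrite -(ler_nat R) => /le_trans; apply; rewrite natrM ler_pM ?(ltW C0) ?exprn_ge0 //.
  apply: le_trans (ceil_ge _) _; rewrite natr_absz ler_int ler_norm //.
by rewrite -natrX ler_nat -{2}(expn1 n.+1) leq_pexp2l.
Qed.

Lemma automaton_degree_ge (R : realType) (A : set (treeaut m)) a :
  finite_set A -> A a -> (degree R a <= automaton_degree R A)%E.
Proof.
move=> finA Aa; rewrite /automaton_degree fsbig_finite //=.
by apply: le_bigmax_seq => //; rewrite in_fset_set // inE.
Qed.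

Section Blocks.
Variables (A : set (treeaut m)) (s : seq (treeaut m)).
Hypothesis As : A = [set` s].
Hypothesis secA : forall a x, A a -> A (tsec a [:: x]).

Lemma automaton_section a w : A a -> A (tsec a w).
Proof.
elim: w a => [|x w IH] a Aa; first by rewrite treeaut_section_nil.
by rewrite -cat1s treeaut_section_cat; apply/IH/secA.
Qed.

(** A cycle longer than the number of states visits some state twice, and the part between the two
    visits can be cut out. *)
Lemma short_loop b u : A b -> u != [::] -> tsec b u = b ->
  exists w, [/\ w != [::], (size w <= size s)%N & tsec b w = b].
Proof.
have [n] := ubnP (size u); elim: n u => // n IH u un Ab u0 bu.
have [us|su] := leqP (size u) (size s); first by exists u.
(* Only nonempty prefixes are compared, so the shortened word stays nonempty. *)
have [i [j [ij ju E]]] : exists i j,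
    [/\ (i < j)%N, (j < size u)%N & tsec b (take i.+1 u) = tsec b (take j.+1 u)].
  apply: (repeated_value (f := fun i => tsec b (take i.+1 u)) su) => i _.
  by have := automaton_section (take i.+1 u) Ab; rewrite As.
apply: (IH (take i.+1 u ++ drop j.+1 u)) => //.
- by rewrite size_cat size_takel ?size_drop ?(leq_trans ij (ltnW ju)) //; lia.
- by case: (u) u0.
- by rewrite treeaut_section_cat E -treeaut_section_cat cat_take_drop.
Qed.

Lemma section_power b w k : tsec b w = b -> tsec b (flatten (nseq k w)) = b.
Proof.
move=> bw; elim: k => [|k IH]; first exact: treeaut_section_nil.
by rewrite /= treeaut_section_cat bw.
Qed.

(* A simple cycle of the automaton has length at most [size s], so it divides the
   block length [(size s)`!] and becomes a loop over the alphabet of blocks. *)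
Let L0 : (0 < (size s)`!)%N. Proof. exact: fact_gt0. Qed.

Lemma foldl_tree_sec b (v : seq ((size s)`!.-tuple 'I_m)) :
  foldl (ss_sec (tree_selfsim m L0)) b v = tsec b (flatten (map val v)).
Proof.
elim: v b => [|w v IH] b /=; first by rewrite treeaut_section_nil.
by rewrite IH treeaut_section_cat.
Qed.

Lemma block_loop b (v : seq ((size s)`!.-tuple 'I_m)) : A b -> v != [::] ->
  foldl (ss_sec (tree_selfsim m L0)) b v = b ->
  exists x : (size s)`!.-tuple 'I_m, ss_sec (tree_selfsim m L0) b x = b.
Proof.
rewrite foldl_tree_sec => Ab v0 bv.
have fv0 : flatten (map val v) != [::].
  case: v v0 {bv} => // w v _ /=; rewrite -size_eq0 size_cat size_tuple.
  by rewrite -lt0n addn_gt0 L0.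
have [w [w0 ws bw]] := short_loop Ab fv0 bv.
have wd : dvdn (size w) (size s)`!.
  by apply: dvdn_fact; rewrite ws lt0n size_eq0 w0.
have wL : size (flatten (nseq ((size s)`! %/ size w)%N w)) == (size s)`!.
  by rewrite size_flatten /shape map_nseq sumn_nseq mulnC divnK.
exists (Tuple wL); exact: section_power.
Qed.

End Blocks.

Lemma generated_subgroup_sgp (A : set (treeaut m)) : is_subgroup (generated_subgroup A).
Proof.
rewrite /generated_subgroup /smallest; split.
- by move=> H [[]]; rewrite inE.
- move=> x y xA yA H HA; have [HG _] := HA.
  have := group_closedM HG; move=> /(_ x y).
  by rewrite !inE; apply; [exact: xA|exact: yA].
- move=> x xA H HA; have [HG _] := HA.
  by have := group_closedV HG; move=> /(_ x); rewrite !inE; apply; exact: xA.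
Qed.

Lemma generated_subgroup_sub (A H : set (treeaut m)) : is_subgroup H -> A `<=` H ->
  generated_subgroup A `<=` H.
Proof.
move=> [H1 HM HV] AH; apply: smallest_sub => //; split; first by rewrite inE.
by move=> x y; rewrite !inE => Hx Hy; apply: HM => //; exact: HV.
Qed.

End Automata.

Theorem theorem1 (R : realType) (m : nat) (hm : (2 <= m)%N)
    (A : set (treeaut m)) (hA : automaton A)
    (hdeg : automaton_degree R A = (1%Z)%:E) :
  amenable R (generated_subgroup A).
Proof.
have [finA sA] := hA; have [s As] := (finite_seqP A).1 finA.
have secA a x : A a -> A (treeaut_section a [:: x]) by move=> Aa; exact: sA.
pose S := tree_selfsim m (fact_gt0 (size s)).
apply: amen_amenable; first exact: generated_subgroup_sgp.
apply: amen_subset (amen_linear S R); first exact: generated_subgroup_sgp.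
apply: generated_subgroup_sub.
  exact: good_sgp (ext_good (ext_good (finitary_good S))).
move=> a Aa; apply: (linear_activity_ext (A := A)) => //.
- by move=> b x; exact: (automaton_section secA).
- by move=> b v; exact: (block_loop As secA).
have [|C aC] := @degree_le1_activity m R a.
  by rewrite -hdeg; exact: automaton_degree_ge.
(* A level of [n] blocks is a level of [n] times the block length in letters. *)
exists (C * (size s)`!)%N => n; rewrite cnt_activity.
apply: leq_trans (aC _) _; rewrite -mulnA leq_mul2l mulnS.
by rewrite -addn1 addnC leq_add ?fact_gt0 ?orbT // mulnC.
Qed.
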